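(* Assume the standing setup with $d$ even. Then the Hodge–Riemann form on $\overline{H}^{d/2}(\Delta)$, namely $(y,z)\mapsto \deg(y z)$, is nondegenerate, and $$D_{d/2} \;=\; \lambda \prod_{F \text{ facet of } \Delta} [F] \quad\in K^{\times}/(K^{\times})^2$$ for some $\lambda \in k^{\times}$ (i.e. for some class $\lambda\in k^\times/(k^\times)^2$).
   Context: Standing setup. $k$ is a field, $d\ge 2$ is an integer, and $\Delta$ is a simplicial complex of dimension $d-1$ with vertex set $V=\{1,\dots,n\}$. $\Delta$ is a connected $k$-homology manifold: $\Delta$ is connected and, for every nonempty face $G$, the link of $G$ has the same homology over $k$ as a sphere of dimension $d-|G|-1$ (in particular every $(d-2)$-dimensional face lies in exactly two facets). $\Delta$ is oriented: if $\mathrm{char}\,k\neq 2$, an orientation is a choice, for each facet, of an ordering of its vertices up to even permutations, such that for every $(d-2)$-face the two orientations induced on it by the two facets containing it are opposite; a facet ordered $v_1,\dots,v_d$ induces on the face omitting $v_i$ the ordering $v_1,\dots,\widehat{v_i},\dots,v_d$ if $i-1$ is even, and the opposite orientation if $i-1$ is odd. If $\mathrm{char}\,k=2$, every such $\Delta$ is regarded as oriented. For a facet $F=\{j_1<\dots<j_d\}$, $\epsilon_F\in\{\pm1\}$ is the sign of the permutation taking $(j_1,\dots,j_d)$ to the chosen ordering ($\epsilon_F=1$ if $\mathrm{char}\,k=2$). Let $K=k(a_{i,j}:1\le i\le d,\ 1\le j\le n)$ with the $a_{i,j}$ independent indeterminates, let $K[\Delta]$ be the Stanley–Reisner ring of $\Delta$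 over $K$ in variables $x_1,\dots,x_n$, and for a face $G$ write $x_G=\prod_{j\in G}x_j$. For a subset $F=\{j_1<\dots<j_d\}\subseteq V$ of size $d$, $[F]\in k[a_{i,j}]$ is the determinant of the $d\times d$ matrix whose $(i,m)$ entry is $a_{i,j_m}$; it is an irreducible polynomial, and $\mathrm{ord}_{[F]}:K^\times\to\mathbb Z$ is the valuation given by order of vanishing along $[F]$, which induces $\mathrm{ord}_{[F]}:K^\times/(K^\times)^2\to\mathbb Z/2\mathbb Z$. Set $\theta_i=\sum_{j}a_{i,j}x_j$ and $H(\Delta)=K[\Delta]/(\theta_1,\dots,\theta_d)$, graded with pieces $H^q(\Delta)$. $H^d(\Delta)$ is one-dimensional and $\deg:H^d(\Delta)\to K$ is the $K$-linear isomorphism with $\deg(x_F)=\epsilon_F/[F]$ for every facet $F$; for an element $y$ of $H(\Delta)$ (or of $K[\Delta]$), $\deg(y)$ means $\deg$ of its degree-$d$ component (image). The Gorenstein quotient $\overline H(\Delta)$ is $H(\Delta)$ modulo the ideal of all $y$ with $\deg(yz)=0$ for all $z\in H(\Delta)$; $\deg$ descends to it. Let $\ell$ be the image of $x_1+\dots+x_n$. For $0\le q\le d/2$, the Hodge–Riemann form on $\overline H^q(\Delta)$ is $(y,z)\mapsto\deg(\ell^{d-2q}yz)$, and $D_q$ denotes its determinant (the determinant of its Gram matrix in any basis), a well-defined element of $K$ modulo multiplication by nonzero squares; when nonzero it is a class in $K^\times/(K^\times)^2$. *)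

(* Defs.v *)
From HB Require Import structures.
From mathcomp Require Import all_boot all_order all_algebra.
From mathcomp Require Import fraction.
From mathcomp Require Import mpoly.
Set Implicit Arguments. Unset Strict Implicit. Unset Printing Implicit Defensive.
Import Order.TTheory GRing.Theory Num.Theory.
Local Open Scope ring_scope.

(* Vertex set V = {1,...,n} is modelled by 'I_n (0-based). A simplicial
   complex is a family of faces Delta : {set {set 'I_n}}. *)

Section Complex.
Variable n : nat.
Implicit Types (D L : {set {set 'I_n}}) (F G H : {set 'I_n}).

Definition is_complex D :=
  [/\ set0 \in D,
      (forall F G, F \in D -> G \subset F -> G \in D) &
      (forall v : 'I_n, [set v] \in D)].

(* dimension d-1: largest face has exactly d vertices *)
Definition has_dim D (d : nat) :=
  (exists2 F, F \in D & #|F| = d) /\ (forall F, F \in D -> (#|F| <= d)%N).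

Definition facet D F := (F \in D) && [forall G, (G \in D) ==> (F \subset G) ==> (G == F)].

Definition edge_rel D : rel 'I_n := fun u v => [set u; v] \in D.
Definition complex_connected D := forall u v : 'I_n, connect (edge_rel D) u v.

Definition link D G := [set H in D | [disjoint H & G] && (H :|: G \in D)].

Definition faces_sz L (s : nat) := [set F in L | #|F| == s].

(* rank over k of the simplicial boundary map C_{s-1} -> C_{s-2}
   (chains on faces with s vertices to faces with s-1 vertices); the sign of
   the face sigma \ {v} in the boundary of sigma is (-1)^(position of v in
   sigma), vertices being ordered increasingly. *)
Definition bd_mx (k : fieldType) L (s : nat) :
  'M[k]_(#|faces_sz L s|, #|faces_sz L s.-1|) :=
  \matrix_(i < #|faces_sz L s|, j < #|faces_sz L s.-1|)
    (let sg : {set 'I_n} := enum_val (A := mem (faces_sz L s)) i in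
     let tau : {set 'I_n} := enum_val (A := mem (faces_sz L s.-1)) j in
     if tau \subset sg then
       (-1) ^+ (\sum_(v in sg :\: tau) #|[set u in sg | (u < v)%N]|)%N
     else 0).

Definition bd_rank (k : fieldType) L (s : nat) : nat :=
  if s is 0 then 0%N else \rank (bd_mx k L s).

(* dimension over k of the reduced simplicial homology group of L in
   dimension s-1 (s = number of vertices of the chains; s = 0 is the
   augmentation degree -1). *)
Definition red_hom_dim (k : fieldType) L (s : nat) : nat :=
  (#|faces_sz L s| - bd_rank k L s - bd_rank k L s.+1)%N.

(* L has the same reduced homology over k as a sphere of dimension m,
   where m + 1 = msz (msz = 0 is the (-1)-sphere, i.e. the complex {emptyset}) *)
Definition homology_sphere (k : fieldType) L (msz : nat) :=
  forall s : nat, red_hom_dim k L s = (s == msz).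

Definition homology_manifold (k : fieldType) D (d : nat) :=
  complex_connected D /\
  forall G, G \in D -> G != set0 -> homology_sphere k (link D G) (d - #|G|).

Definition inversions (s : seq 'I_n) : nat :=
  let t := map (@nat_of_ord n) s in
  (\sum_(a < size s) \sum_(b < size s) ((a < b)%N && (nth 0 t b < nth 0 t a)%N))%N.

Definition seq_sign (s : seq 'I_n) : int := (-1) ^+ inversions s.

(* sign (relative to the increasing ordering of the face) of the orientation
   induced by the ordering s of a facet on the face obtained by omitting v:
   the ordering of s with v removed, reversed iff (position of v) - 1 is odd *)
Definition induced_sign (s : seq 'I_n) (v : 'I_n) : int :=
  (-1) ^+ (index v s) * seq_sign (rem v s).

Definition oriented (k : fieldType) D (o : {set 'I_n} -> seq 'I_n) :=
  (2 \notin [pchar k])%N ->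
  (forall F, facet D F -> perm_eq (o F) (enum F)) /\
  (forall F F' v v', facet D F -> facet D F' -> F != F' ->
     v \in F -> v' \in F' -> F :\ v = F' :\ v' ->
     induced_sign (o F) v = - induced_sign (o F') v').

Definition eps (k : fieldType) (o : {set 'I_n} -> seq 'I_n) F : int :=
  if (2 \in [pchar k])%N then 1 else seq_sign (o F).

End Complex.

Definition Kpoly (k : fieldType) (d n : nat) := {mpoly k[d * n]}.
Definition Kfield (k : fieldType) (d n : nat) := {fraction Kpoly k d n}.

Section Algebra.
Variables (k : fieldType) (d n : nat).
Local Notation P := (Kpoly k d n).
Local Notation K := (Kfield k d n).

Definition avar (i : 'I_d) (j : 'I_n) : P := 'X_(mxvec_index i j).

(* [F] : determinant of the d x d matrix with (i,m) entry a_{i, j_m},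
   where j_1 < ... < j_d are the elements of F (m-th smallest element
   = the unique j in F with exactly m elements of F below it) *)
Definition bracket (F : {set 'I_n}) : P :=
  \det (\matrix_(i < d, m < d)
          \sum_(j in F | #|[set u in F | (u < j)%N]| == m :> nat) avar i j).

Definition toK (p : P) : K := tofrac p.
Definition kK (c : k) : K := toK (mpolyC _ c).

Local Notation R := {mpoly K[n]}.

Definition xmon (G : {set 'I_n}) : R := \prod_(j in G) 'X_j.

Definition theta (i : 'I_d) : R := \sum_(j < n) toK (avar i j) *: 'X_j.

Definition in_ideal (D : {set {set 'I_n}}) (p : R) :=
  exists (c : {set 'I_n} -> R) (e : 'I_d -> R),
    p = \sum_(N : {set 'I_n} | N \notin D) c N * xmon N
        + \sum_(i < d) e i * theta i.

(* degf is the map deg : H^d(Delta) -> K, given on representatives: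
   K-linear on degree-d forms, zero on the degree-d part of the ideal, and
   deg(x_F) = eps_F / [F] on facets *)
Definition is_deg (D : {set {set 'I_n}}) (o : {set 'I_n} -> seq 'I_n)
    (degf : R -> K) :=
  [/\ (forall (a : K) (p q : R), p \is d.-homog -> q \is d.-homog ->
          degf (a *: p + q) = a * degf p + degf q),
      (forall p : R, p \is d.-homog -> in_ideal D p -> degf p = 0) &
      (forall F, facet D F -> degf (xmon F) = (eps k o F)%:~R / toK (bracket F))].

Definition Deg (degf : R -> K) (y : R) : K := degf (pihomog mdeg d y).

Definition in_gor_ideal (degf : R -> K) (y : R) :=
  forall z : R, Deg degf (y * z) = 0.

(* b (of size r, homogeneous of degree q) projects to a K-basis of
   \overline H^q(Delta) *)
Definition is_gor_basis (degf : R -> K) (q r : nat) (b : 'I_r -> R) :=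
  [/\ (forall i, b i \is q.-homog),
      (forall p : R, p \is q.-homog ->
         exists c : 'I_r -> K, in_gor_ideal degf (p - \sum_(i < r) c i *: b i)) &
      (forall c : 'I_r -> K, in_gor_ideal degf (\sum_(i < r) c i *: b i) ->
         forall i, c i = 0)].

Definition ell : R := \sum_(j < n) 'X_j.

Definition HR_gram (degf : R -> K) (q r : nat) (b : 'I_r -> R) : 'M[K]_r :=
  \matrix_(i, j) Deg degf (ell ^+ (d - 2 * q) * b i * b j).

End Algebra.

(* Main.v *)
Require Import Defs.
From HB Require Import structures.
From mathcomp Require Import all_boot all_order all_algebra.
From mathcomp Require Import fraction.
From mathcomp Require Import mpoly.
From mathcomp Require Import ring.
Set Implicit Arguments. Unset Strict Implicit. Unset Printing Implicit Defensive.
Import Order.TTheory GRing.Theory Num.Theory.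
Local Open Scope ring_scope.

(* Let p_F, for a facet F, be the point supported on F where theta_1 = 1 and
   theta_2 = ... = theta_d = 0. In degree d the map deg is the weighted sum of
   evaluations phi(q) = sum_F w_F q(p_F), w_F = eps_F / ([F] prod_(j in F) p_(F,j)):
   both functionals kill the non-faces and the theta_i (for theta_1 because phi
   vanishes in degree d - 1, where the two facets on each ridge cancel), and they
   agree on the x_F. So the Hodge-Riemann form on degree h = d/2 is induced from the
   diagonal form <w_F> on K^facets, through the space U of evaluations of forms of
   degree h, by dividing out the radical of U.

   The point is that U is coisotropic: U^perp is contained in U. Let g be orthogonal
   to U. On the star of a vertex v, g is the evaluation of a polynomial of degree
   < h: this uses that the links of all faces containing v are homology spheres, the
   relations theta_i being imposed one at a time on the complex of polynomial
   functions on faces. Hence x_v g lies in U for every v, and so does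
   g = theta_1 g = sum_v a_(1,v) x_v g.

   Consequently the determinant of the form is +- prod_F w_F up to squares. By
   Cramer's rule [F] p_(F,j) depends only on the ridge F - j up to sign, each ridge
   lies in two facets, and d is even, so prod_F w_F is +- prod_F [F] up to squares. *)

(** * Signed boundary operators and acyclic stars *)

Definition below n (G : {set 'I_n}) (u : 'I_n) : nat :=
  #|[set w in G | (w < u)%N]|.

(** Chains are functions on all subsets, of every size at once; the value at [G] is the coefficient
    of [G] in the simplicial boundary of [c], a sum over the faces with one more vertex. *)
Definition bd n (R : nzRingType) (D : {set {set 'I_n}}) (c : {set 'I_n} -> R)
    (G : {set 'I_n}) : R :=
  \sum_(u | (u \notin G) && (u |: G \in D)) (-1) ^+ below G u * c (u |: G).

Section Boundary.
Variable n : nat.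
Implicit Types (D L : {set {set 'I_n}}) (F G H U : {set 'I_n}) (u v w : 'I_n).

Lemma below_setU1 G u w : u \notin G -> below (u |: G) w = ((u < w) + below G w)%N.
Proof.
move=> uG; rewrite /below; case: ltnP => uw.
  rewrite (_ : [set _ in _ | _] = u |: [set x in G | (x < w)%N]).
    by rewrite cardsU1 inE (negbTE uG).
  by apply/setP=> x; rewrite !inE; case: eqP => // ->; rewrite uw.
apply: eq_card => x; rewrite !inE; case: eqP => // ->.
by rewrite ltnNge uw (negbTE uG).
Qed.

Lemma below_setU1_self G u : below (u |: G) u = below G u.
Proof.
by apply: eq_card => x; rewrite !inE; case: eqP => // ->; rewrite ltnn !andbF.
Qed.

Definition closed_down D := forall F G, F \in D -> G \subset F -> G \in D.

(** The terms are indexed by ordered pairs of added vertices, and the two orders cancel: adding the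
    smaller vertex first raises [below] at the larger one by 1, while the other order changes
    nothing. *)
Lemma bd_bd (R : nzRingType) D (c : {set 'I_n} -> R) G :
  closed_down D -> bd D (bd D c) G = 0.
Proof.
move=> clD; rewrite /bd.
pose P (p : 'I_n * 'I_n) := [&& p.1 \notin G, p.2 \notin G, p.1 != p.2 &
   p.2 |: (p.1 |: G) \in D].
pose T (p : 'I_n * 'I_n) := (-1) ^+ (below G p.1 + below (p.1 |: G) p.2)
   * c (p.2 |: (p.1 |: G)).
have -> : \sum_(u | (u \notin G) && (u |: G \in D)) (-1) ^+ below G u *
     (\sum_(w | (w \notin u |: G) && (w |: (u |: G) \in D))
        (-1) ^+ below (u |: G) w * c (w |: (u |: G))) = \sum_(p | P p) T p.
  under eq_bigr => u _ do rewrite big_distrr /=.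
  rewrite pair_big_dep /=; apply: eq_big => [[u w]|[u w] _] /=; last first.
    by rewrite /T exprD mulrA.
  rewrite /P /= !inE negb_or (eq_sym w u).
  case: (boolP (w |: (u |: G) \in D)) => [wD|]; last by rewrite !andbF.
  rewrite (clD _ _ wD) ?subsetUr // !andbT.
  by case: (_ \in _) => //=; rewrite andbC.
rewrite (bigID (fun p : 'I_n * 'I_n => (p.1 < p.2)%N)) /=.
rewrite [X in _ + X](reindex_inj (h := fun p => (p.2, p.1))) /=; last first.
  by move=> [a b] [x y] /= [-> ->].
rewrite -[X in _ + X]opprK -sumrN.
set S := (X in X + _); rewrite -[RHS](subrr S); congr (_ - _).
apply: eq_big => [[u w]|[u w]].
  rewrite /P /= (setUCA [set w]) (eq_sym w u) -leqNgt leq_eqVlt.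
  case: (boolP (u \in G)); case: (boolP (w \in G)) => //= _ _.
  by rewrite -(inj_eq val_inj) /=; case: ltngtP.
move=> /andP[]; rewrite /P /T /= => /and4P[wG uG neq _].
rewrite -leqNgt => le_uw; have {neq le_uw} uw : (u < w)%N.
  by rewrite ltn_neqAle le_uw andbT eq_sym.
rewrite !below_setU1 // uw (ltnNge w u) (ltnW uw) /= (setUCA [set w]).
rewrite add0n [(true + _)%N]add1n addnS exprS addnC mulN1r mulNr.

by [].
Qed.

Lemma eq_bd (R : nzRingType) D (c c' : {set 'I_n} -> R) G :
  (forall u, u \notin G -> u |: G \in D -> c (u |: G) = c' (u |: G)) ->
  bd D c G = bd D c' G.
Proof. by move=> h; apply: eq_bigr => u /andP[uG uD]; rewrite h. Qed.

Lemma bd_lin (R : comNzRingType) D (a : R) (c c' : {set 'I_n} -> R) G :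
  bd D (fun F => c F + a * c' F) G = bd D c G + a * bd D c' G.
Proof.
rewrite /bd mulr_sumr -big_split; apply: eq_bigr => u _.
by rewrite mulrDr mulrCA.
Qed.

End Boundary.

Section ChainMatrix.
Variables (n : nat) (K : fieldType).
Implicit Types (D L : {set {set 'I_n}}) (F G H U : {set 'I_n}).

Definition chain_row L s (c : {set 'I_n} -> K) : 'rV[K]_#|faces_sz L s| :=
  \row_(i < #|faces_sz L s|) c (enum_val (A := mem (faces_sz L s)) i).

Lemma chain_rowP L s c c' :
  (forall G, G \in L -> #|G| = s -> c G = c' G) <-> chain_row L s c = chain_row L s c'.
Proof.
split=> [h|h G GL Gs].
  by apply/rowP => i; rewrite !mxE; have := enum_valP i; rewrite inE => /andP[? /eqP ?]; apply: h.
have GF : G \in faces_sz L s by rewrite inE GL Gs eqxx.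
have := congr1 (fun m : 'rV_#|faces_sz L s| => m 0 (enum_rank_in GF G)) h.
by rewrite !mxE enum_rankK_in.
Qed.

Lemma chain_row_surj L s (r : 'rV[K]_#|faces_sz L s|) : exists c, r = chain_row L s c.
Proof.
exists (fun G => \sum_(i < #|faces_sz L s|) (enum_val (A := mem (faces_sz L s)) i == G)%:R * r 0 i).
apply/rowP => i; rewrite mxE (bigD1 i) //= eqxx mul1r big1 ?addr0 // => j ji.
by rewrite (inj_eq enum_val_inj) (negbTE ji) mul0r.
Qed.

(** Bridge to the matrices that define homology. The faces of size [s.+1] above [tau] are the sets
    [u |: tau], and the exponent in [bd_mx] then has the single term [below tau u]. *)
Lemma chain_row_bd L s c :
  chain_row L s.+1 c *m bd_mx K L s.+1 = chain_row L s (bd L c).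
Proof.
apply/rowP => j; rewrite !mxE /=.
set tau := enum_val (A := mem (faces_sz L s)) j.
have := enum_valP j; rewrite inE -/tau => /andP[tauL /eqP taus].
under eq_bigr => i _ do rewrite !mxE -/tau.
rewrite -(big_enum_val (fun sg => c sg * (if tau \subset sg then
  (-1) ^+ (\sum_(v in sg :\: tau) #|[set u in sg | (u < v)%N]|)%N else 0))) /=.
rewrite (bigID (fun sg : {set 'I_n} => tau \subset sg)) /= [X in _ + X]big1 ?addr0; last first.
  by move=> sg /andP[_ /negbTE ->]; rewrite mulr0.
pose P := [set u | (u \notin tau) && (u |: tau \in L)].
rewrite (eq_bigl (mem [set u |: tau | u in P])); last first.
  move=> sg; rewrite inE; apply/andP/imsetP => [[/andP[sgL /eqP sgs] tsg]|[u]].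
    have /cards1P[u hu] : #|sg :\: tau| == 1%N.
      by rewrite cardsDS // sgs taus subSnn.
    have sgE : sg = u |: tau 
      by rewrite -hu setUC; apply/esym; rewrite setDE setUIr setUCr setIT; apply/setUidPr.
    have : u \in sg :\: tau by rewrite hu set11.
    by rewrite inE => /andP[ut usg]; exists u; rewrite // inE ut -sgE.
  rewrite inE => /andP[ut uL] ->; split; last exact: subsetUr.
  by rewrite uL cardsU1 ut taus add1n eqxx.
rewrite big_imset /=; last first.
  move=> u w; rewrite !inE => /andP[ut _] /andP[wt _] /setP/(_ u).
  by rewrite !inE eqxx (negbTE ut) !orbF => /esym/eqP.
apply: eq_big => [u|u]; rewrite inE // => /andP[ut _].
rewrite subsetUr (_ : (u |: tau) :\: tau = [set u]); last first.
  by rewrite setDUl setDv setU0; apply/setDidPl; rewrite disjoints1.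
by rewrite big_set1 mulrC; congr (_ ^+ _ * _); exact: below_setU1_self.
Qed.

Lemma bd_mx_bd_mx L s : closed_down L ->
  (bd_mx K L s.+2 *m bd_mx K L s.+1 = 0).
Proof.
move=> clL; apply/row_matrixP => i; rewrite row0 rowE mulmxA.
have [c ->] := chain_row_surj (delta_mx 0 i : 'rV[K]_#|faces_sz L s.+2|).
rewrite chain_row_bd chain_row_bd; apply/rowP => j.
by rewrite !mxE bd_bd.
Qed.

(** [red_hom_dim] is a truncated difference, so its vanishing only bounds the rank of the incoming
    boundary from below. Since [bd] squares to zero, this image lies in the kernel, and the bound
    forces equality. *)
Lemma acyclic_exact L s (c : {set 'I_n} -> K) : closed_down L -> red_hom_dim K L s.+1 = 0%N ->
  (forall G, G \in L -> #|G| = s -> bd L c G = 0) ->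
  exists c', forall G, G \in L -> #|G| = s.+1 -> c G = bd L c' G.
Proof.
move=> clL hom cyc.
have sub : (bd_mx K L s.+2 <= kermx (bd_mx K L s.+1))%MS.
  by apply/sub_kermxP; apply: bd_mx_bd_mx.
have := mxrank_leqif_eq sub; rewrite mxrank_ker => -[le eq].
have : \rank (bd_mx K L s.+2) == (#|faces_sz L s.+1| - \rank (bd_mx K L s.+1))%N.
  rewrite eqn_leq le -subn_eq0.
  by move: hom; rewrite /red_hom_dim /bd_rank => ->.
rewrite eq => /andP[_ kle].
have : (chain_row L s.+1 c <= bd_mx K L s.+2)%MS.
  apply: submx_trans kle; apply/sub_kermxP; rewrite chain_row_bd.
  by apply/rowP => j; rewrite !mxE cyc //; have := enum_valP j; rewrite inE => /andP[? /eqP].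
case/submxP => r; have [c' ->] := chain_row_surj r.
by rewrite chain_row_bd => /chain_rowP h; exists c'.
Qed.

(** On the empty face every chain is a cycle; vanishing homology makes the boundary map from
    vertices surjective. *)
Lemma acyclic_bot L (c : {set 'I_n} -> K) : set0 \in L -> red_hom_dim K L 0 = 0%N ->
  exists c', c set0 = bd L c' set0.
Proof.
move=> L0; rewrite /red_hom_dim /bd_rank /= subn0 => /eqP.
rewrite subn_eq0 => le.
have : (chain_row L 0 c <= bd_mx K L 1)%MS.
  apply: submx_full; rewrite /row_full eqn_leq rank_leq_col; exact: le.
case/submxP => r; have [c' ->] := chain_row_surj r.
by rewrite chain_row_bd => /chain_rowP h; exists c'; apply: h; rewrite ?cards0.
Qed.

(** There are no faces of size [s.+2], so homology in size [s.+1] is the cycle space itself, a line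
    spanned by the nonzero cycle [e]. *)
Lemma top_cycle_unique L s (c e : {set 'I_n} -> K) :
  closed_down L -> red_hom_dim K L s.+1 = 1%N ->
  (forall G, G \in L -> (#|G| <= s.+1)%N) ->
  (forall G, G \in L -> #|G| = s -> bd L e G = 0) ->
  (exists2 G, G \in L & (#|G| == s.+1) && (e G != 0)) ->
  (forall G, G \in L -> #|G| = s -> bd L c G = 0) ->
  exists a, forall G, G \in L -> #|G| = s.+1 -> c G = a * e G.
Proof.
move=> clL hom top ecyc [G0 G0L /andP[/eqP G0s eG0]] cyc.
have r0 : \rank (bd_mx K L s.+2) = 0%N.
  apply/eqP; rewrite -leqn0 (leq_trans (rank_leq_row _)) // leqn0 cards_eq0.
  by apply/set0Pn => -[G]; rewrite inE => /andP[/top GL /eqP Gs]; rewrite Gs ltnn in GL.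
have kr : \rank (kermx (bd_mx K L s.+1)) = 1%N.
  by rewrite mxrank_ker; move: hom; rewrite /red_hom_dim /bd_rank r0 subn0.
have ker g : (forall G, G \in L -> #|G| = s -> bd L g G = 0) ->
    (chain_row L s.+1 g <= kermx (bd_mx K L s.+1))%MS.
  move=> gcyc; apply/sub_kermxP; rewrite chain_row_bd.
  by apply/rowP => j; rewrite !mxE gcyc //; have := enum_valP j; rewrite inE => /andP[? /eqP].
have /mxrank_leqif_eq[_] := ker e ecyc.
rewrite kr rank_rV.
have -> : chain_row L s.+1 e != 0.
  apply: contraNneq eG0 => h.
  suff : e G0 = (fun=> 0) G0 by move=> ->.
  move: G0 G0L G0s; apply/chain_rowP; rewrite h; apply/rowP => j; by rewrite !mxE.
rewrite eqxx => /esym/andP[_ /(submx_trans (ker c cyc))].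
case/sub_rVP => a /rowP h; exists a; apply/chain_rowP.
by apply/rowP => j; move: (h j); rewrite !mxE.
Qed.

End ChainMatrix.

Lemma disjoint_setU1 (T : finType) (u : T) (A B : {set T}) :
  [disjoint u |: A & B] = (u \notin B) && [disjoint A & B].
Proof. by rewrite -setI_eq0 setIUl setU_eq0 !setI_eq0 disjoints1. Qed.

Section Star.
Variables (n : nat) (K : fieldType) (D : {set {set 'I_n}}) (U : {set 'I_n}).
Hypotheses (clD : closed_down D) (UD : U \in D).
Implicit Types (F G H : {set 'I_n}) (c : {set 'I_n} -> K).
Let L := link D U.

Lemma link_closed : closed_down L.
Proof.
move=> F G; rewrite !inE => /and3P[FD FU FUD] GF; rewrite (clD FD GF) /=.
rewrite (disjointWl GF FU) /=; apply: clD FUD _; exact: setSU.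
Qed.

Lemma mem_link H : (H \in L) = [disjoint H & U] && (H :|: U \in D).
Proof.
rewrite inE; case: (boolP (H :|: U \in D)) => [h|]; last by rewrite !andbF.
by rewrite (clD h) // subsetUl.
Qed.

(* The sign absorbs the vertices of U when faces of the link are read as faces
   containing U. *)
Definition twist c H : K := (-1) ^+ (\sum_(w in H) below U w)%N * c (H :|: U).

Lemma bd_twist c H : H \in L ->
  bd L (twist c) H = (-1) ^+ (\sum_(w in H) below U w)%N * bd D c (H :|: U).
Proof.
rewrite mem_link => /andP[HU HUD]; rewrite /bd big_distrr /=.
apply: eq_big => [u|u /andP[uH uL]].
  rewrite mem_link in_setU negb_or -setUA disjoint_setU1.
  by rewrite HU; case: (u \in H); case: (u \in U).
have uU : u \notin U.
  by move: uL; rewrite mem_link disjoint_setU1 => /andP[/andP[]].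
rewrite /twist (bigD1 u) ?setU11 //= (eq_bigl (mem H)); last first.
  by move=> w; rewrite !inE; case: (eqVneq w u) => [->|]; rewrite ?andbT // (negbTE uH).
rewrite exprD setUA !mulrA; congr (_ * _).
have -> : below (H :|: U) u = (below H u + below U u)%N.
  rewrite /below -cardsUI [X in (_ + X)%N](_ : _ = 0%N) ?addn0.
    by apply: eq_card => w; rewrite !inE andb_orl.
  apply/eqP; rewrite cards_eq0; apply/eqP/setP => w; rewrite !inE.
  by case wH: (w \in H); rewrite //= (disjointFr HU wH) andbF.
by rewrite exprD; ring.
Qed.

Lemma star_link G : G \in D -> U \subset G ->
  G :\: U \in L /\ (G :\: U) :|: U = G.
Proof.
move=> GD UG; have E : (G :\: U) :|: U = G.
  by apply/setP=> w; rewrite !inE; have := subsetP UG w; case: (w \in U) => [->//|]; rewrite ?orbF ?andbT.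
by rewrite mem_link E GD andbT disjoint_sym -setI_eq0; split=> //; apply/eqP/setP => w;
  rewrite !inE; case: (w \in U).
Qed.

Lemma card_star_link H : H \in L -> #|H :|: U| = (#|H| + #|U|)%N.
Proof.
rewrite mem_link -setI_eq0 => /andP[/eqP HU _].
by rewrite cardsU HU cards0 subn0.
Qed.

Definition untwist c G : K := (-1) ^+ (\sum_(w in G :\: U) below U w)%N * c (G :\: U).

Lemma untwistK c H : H \in L -> twist (untwist c) H = c H.
Proof.
rewrite mem_link => /andP[HU _]; rewrite /twist /untwist.
have -> : (H :|: U) :\: U = H by rewrite setDUl setDv setU0; apply/setDidPl.
by rewrite mulrA -expr2 sqrr_sign mul1r.
Qed.

(** Through [twist], chains on the faces containing [U] become chains on the link of [U], with sizes
    lowered by [#|U|]. *)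
Lemma star_exact s c :
  (#|U| <= s)%N -> red_hom_dim K L (s - #|U|) = 0%N ->
  (forall G, G \in D -> U \subset G -> #|G|.+1 = s -> bd D c G = 0) ->
  exists c', forall G, G \in D -> U \subset G -> #|G| = s -> c G = bd D c' G.
Proof.
move=> Us hom cyc.
suff [c' hc'] : exists c', forall H, H \in L -> #|H| = (s - #|U|)%N -> twist c H = bd L c' H.
  exists (untwist c') => G GD UG Gs.
  have [HL HE] := star_link GD UG.
  have := hc' _ HL; rewrite -(addnK #|U| #|G :\: U|) -card_star_link // HE Gs.
  move=> /(_ erefl); have <- : bd L (twist (untwist c')) (G :\: U) = bd L c' (G :\: U).
    by apply: eq_bd => u _ uL; rewrite untwistK.
  rewrite bd_twist // /twist HE.
  move/(congr1 ( *%R ((-1) ^+ (\sum_(w in G :\: U) below U w)%N))).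
  by rewrite !mulrA -!expr2 !sqrr_sign !mul1r.
(* When [s = #|U|] the face of the link is empty, and [acyclic_bot] takes the place of
   [acyclic_exact]. *)
case: (posnP (s - #|U|)) => [s0|]; last first.
  move=> s0; rewrite -(prednK s0) in hom *.
  apply: (acyclic_exact link_closed hom).
    move=> H HL Hs; rewrite bd_twist // cyc ?mulr0 //; rewrite ?subsetUr //.
      by move: HL; rewrite mem_link => /andP[].
  by rewrite card_star_link // Hs -addSn prednK // subnK.
rewrite s0 in hom *.
have L0 : set0 \in L by rewrite mem_link set0U UD andbT -setI_eq0 set0I.
have [c' hc'] := acyclic_bot (twist c) L0 hom.
by exists c' => H _ /eqP; rewrite cards_eq0 => /eqP ->.
Qed.

Lemma star_top_unique s c e :
  (#|U| < s)%N -> red_hom_dim K L (s - #|U|) = 1%N ->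
  (forall G, G \in D -> (#|G| <= s)%N) ->
  (forall G, G \in D -> U \subset G -> #|G|.+1 = s -> bd D e G = 0) ->
  (exists2 G, G \in D & [&& U \subset G, #|G| == s & e G != 0]) ->
  (forall G, G \in D -> U \subset G -> #|G|.+1 = s -> bd D c G = 0) ->
  exists a, forall G, G \in D -> U \subset G -> #|G| = s -> c G = a * e G.
Proof.
move=> Us hom top ecyc [G0 G0D /and3P[UG0 /eqP G0s eG0]] cyc.
have s0 : (0 < s - #|U|)%N by rewrite subn_gt0.
rewrite -(prednK s0) in hom.
have tw g : (forall G, G \in D -> U \subset G -> #|G|.+1 = s -> bd D g G = 0) ->
    forall H, H \in L -> #|H| = (s - #|U|).-1 -> bd L (twist g) H = 0.
  move=> gcyc H HL Hs; rewrite bd_twist // gcyc ?mulr0 //; rewrite ?subsetUr //.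
    by move: HL; rewrite mem_link => /andP[].
  by rewrite card_star_link // Hs -addSn prednK // subnK // ltnW.
have [] := top_cycle_unique link_closed hom _ (tw _ ecyc) _ (tw _ cyc).
- move=> H HL; rewrite prednK // leq_subRL ?(ltnW Us) // addnC -card_star_link //.
  by apply: top; move: HL; rewrite mem_link => /andP[].
- have [HL HE] := star_link G0D UG0.
  exists (G0 :\: U) => //; rewrite /twist HE mulf_neq0 ?signr_eq0 // andbT prednK //.
  by rewrite cardsDS // G0s.
move=> a ha; exists a => G GD UG Gs.
have [HL HE] := star_link GD UG.
have := ha _ HL; rewrite cardsDS // Gs prednK // => /(_ erefl).
rewrite /twist HE mulrCA.
move/(congr1 ( *%R ((-1) ^+ (\sum_(w in G :\: U) below U w)%N))).
by rewrite !mulrA -!expr2 !sqrr_sign !mul1r.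
Qed.

End Star.

(** * Orientation signs and the local structure of the manifold *)

Section Inversions.

Let invn (t : seq nat) : nat :=
  (\sum_(a < size t) \sum_(b < size t) ((a < b)%N && (nth 0 t b < nth 0 t a)%N))%N.

Let invn_cons x t : invn (x :: t) = (count (fun y => y < x)%N t + invn t)%N.
Proof.
rewrite /invn /= big_ord_recl /=; congr (_ + _)%N.
  rewrite big_ord_recl /= add0n -sum1_count [RHS]big_mkcond (big_nth 0%N) big_mkord /=.
  by apply: eq_bigr => i _; case: ifP.
apply: eq_bigr => a _; rewrite big_ord_recl /= add0n.
by apply: eq_bigr => b _.
Qed.

(** Inversions involving [v] come from larger letters in [s1] and smaller ones in [s2]. Modulo 2
    their number is the size of [s1] plus the number of smaller letters on both sides. *)
Let odd_insert (f : seq nat -> nat) v (s1 s2 : seq nat) :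
  (forall x t, f (x :: t) = (count (fun y => y < x)%N t + f t)%N) ->
  v \notin s1 ++ s2 ->
  odd (f (s1 ++ v :: s2)) =
  odd (size s1) (+) odd (f (s1 ++ s2)) (+) odd (count (fun y => y < v)%N (s1 ++ s2)).
Proof.
move=> fE; elim: s1 => [|x s1 IH] /=; first by rewrite fE oddD addbC.
rewrite inE negb_or => /andP[vx vs]; rewrite !fE !count_cat /= !oddD IH //.
rewrite (ltnNge x v) [(v <= x)%N]leq_eqVlt (negbTE vx) /= count_cat !oddD.
case: (v < x)%N => /=; case: (odd (size s1)); case: (odd (f _));
  case: (odd (count _ s1)); case: (odd (count _ s2)) => /=;
  case: (odd (count _ s1)); case: (odd (count _ s2)) => //=.
Qed.

(** Translates the sign of an induced orientation into the sign used by [bd]; coherent orientations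
    thereby become cycles in [orientation_cycle]. *)
Lemma seq_sign_induced n (s : seq 'I_n) (F : {set 'I_n}) v :
  perm_eq s (enum F) -> v \in F -> seq_sign s = induced_sign s v * (-1) ^+ below F v.
Proof.
move=> sF vF; have us : uniq s by rewrite (perm_uniq sF) enum_uniq.
have vs : v \in s by rewrite (perm_mem sF) mem_enum.
have -> : below F v = count (fun w : 'I_n => (w < v)%N) s.
  rewrite /below (permP sF) -sum1_card -sum1_count big_enum_cond /=.
  by apply: eq_bigl => w; rewrite inE.
rewrite /induced_sign /seq_sign -!exprD -[LHS]signr_odd -[RHS]signr_odd; congr (_ ^+ _).
case/splitPr: vs us => s1 s2 us.
have : v \notin s1 ++ s2 by move: us; rewrite uniq_catC /= => /andP[]; rewrite !mem_cat orbC.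
move=> vs12; have v1 : v \notin s1 by move: vs12; rewrite mem_cat negb_or => /andP[].
have inv (t : seq 'I_n) : inversions t = invn (map (@nat_of_ord n) t).
  by rewrite /inversions /invn size_map.
have -> : rem v (s1 ++ v :: s2) = s1 ++ s2.
  by elim: s1 v1 {us vs12} => [|x s1 IH] /=; rewrite ?eqxx // inE negb_or eq_sym => /andP[/negbTE -> /IH ->].
rewrite !inv !map_cat /= (odd_insert invn_cons); last by rewrite -map_cat (mem_map val_inj).
rewrite size_map index_cat (negbTE v1) /= eqxx addn0 !count_cat /= ltnn add0n !count_map.
by move: (invn _) => N; rewrite [in RHS]oddD [odd (size s1 + N)]oddD.
Qed.

End Inversions.

(** The entries of [bd_mx] are 0 and signs, and rank is invariant under field extension; so the
    homology assumed over [k] is available over [K]. *)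
Lemma bd_rank_map n (k K : fieldType) (f : {rmorphism k -> K}) (L : {set {set 'I_n}}) s :
  bd_rank K L s = bd_rank k L s.
Proof.
case: s => [//|s] /=; rewrite -(mxrank_map f (bd_mx k L s.+1)).
suff -> : bd_mx K L s.+1 = map_mx f (bd_mx k L s.+1) by [].
by apply/matrixP => i j; rewrite !mxE /=; case: ifP => _; rewrite ?rmorph0 ?rmorph_sign.
Qed.

Lemma red_hom_dim_map n (k K : fieldType) (f : {rmorphism k -> K}) (L : {set {set 'I_n}}) s :
  red_hom_dim K L s = red_hom_dim k L s.
Proof. by rewrite /red_hom_dim !(bd_rank_map f). Qed.

Section Manifold.
Variables (k : fieldType) (d n : nat) (D : {set {set 'I_n}}).
Hypotheses (d2 : (2 <= d)%N) (cD : is_complex D) (dimD : has_dim D d)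
  (mfD : homology_manifold k D d).
Implicit Types (F G : {set 'I_n}).

Lemma complex_closed : closed_down D.
Proof. by case: cD. Qed.

Lemma card_face F : F \in D -> (#|F| <= d)%N.
Proof. by case: dimD => _; apply. Qed.

Lemma faces_sz_eq0 (L : {set {set 'I_n}}) s :
  (forall F, F \in L -> #|F| != s) -> faces_sz L s = set0.
Proof. by move=> h; apply/setP=> F; rewrite !inE; apply/andP => -[/h/negbTE ->]. Qed.

Lemma bd_rank_eq0 (L : {set {set 'I_n}}) s :
  (forall F, F \in L -> #|F| != s) -> bd_rank k L s = 0%N.
Proof.
case: s => [//|s] h; apply/eqP; rewrite -leqn0 /= (leq_trans (rank_leq_row _)) //.
by rewrite (faces_sz_eq0 h) cards0.
Qed.

Lemma faces_sz0 (L : {set {set 'I_n}}) : set0 \in L -> faces_sz L 0 = [set set0].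
Proof.
move=> L0; apply/setP=> F; rewrite !inE cards_eq0.
by case: eqP => [->|]; rewrite ?L0 ?andbF.
Qed.

(** Purity: a nonempty maximal face has link [[set set0]], whose homology sits in size 0, so the
    sphere condition forces [d - #|F| = 0]. The empty face is contained in a face of size [d]. *)
Lemma facetE F : facet D F = (F \in D) && (#|F| == d).
Proof.
rewrite /facet; case: (boolP (F \in D)) => //= FD; apply/forallP/eqP => [mx|Fd G]; last first.
  apply/implyP => GD; apply/implyP => FG; rewrite eq_sym eqEcard FG /= Fd.
  exact: card_face.
have mxF G : G \in D -> F \subset G -> G = F.
  by move=> GD FG; have := mx G; rewrite GD FG /= => /eqP.
case: (eqVneq F set0) => [F0|F0].
  case: dimD => -[G GD Gd] _; rewrite -Gd (mxF G) // F0; exact: sub0set.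
have [_ /(_ F FD F0) /(_ 0%N)] := mfD.
have L0 : link D F = [set set0].
  apply/setP => H; rewrite (mem_link _ complex_closed) !inE.
  apply/andP/eqP => [[HF HD]|->].
    have /setUidPr/setIidPl HF' := mxF _ HD (subsetUr _ _).
    by move: HF; rewrite -setI_eq0 HF' => /eqP.
  by rewrite set0U FD -setI_eq0 set0I.
rewrite L0 /red_hom_dim faces_sz0 ?set11 // cards1 (bd_rank_eq0 (s := 1)) => [|G]; last first.
  by rewrite inE => /eqP ->; rewrite cards0.
rewrite /= !subn0; case: (eqVneq 0%N (d - #|F|)%N) => // /esym/eqP; rewrite subn_eq0 => dF _.
by apply/eqP; rewrite eqn_leq dF card_face.
Qed.

(** The link of a ridge is a finite set of points. The homology of the 0-sphere says that its
    augmentation has rank 1 and a kernel of dimension 1, so there are two points. *)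
Lemma ridge_two_facets G : G \in D -> #|G|.+1 = d ->
  #|[set u | (u \notin G) && (u |: G \in D)]| = 2%N.
Proof.
move=> GD Gd.
have G0 : G != set0 by rewrite -card_gt0; move: d2; rewrite -Gd.
have [_ /(_ G GD G0) hom] := mfD.
have L0 : set0 \in link D G by rewrite (mem_link _ complex_closed) set0U GD -setI_eq0 set0I eqxx.
have top F : F \in link D G -> (#|F| <= 1)%N.
  move=> FL; move: (FL); rewrite (mem_link _ complex_closed) => /andP[_ /card_face].
  by rewrite (card_star_link complex_closed FL) -Gd -add1n leq_add2r.
have := hom 0%N; have := hom 1%N.
rewrite /red_hom_dim (faces_sz0 L0) cards1 (bd_rank_eq0 (s := 2)); last first.
  by move=> F /top; case: #|F| => [|[]].
rewrite -Gd subSnn /= !subn0.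
have : (\rank (bd_mx k (link D G) 1) <= 1)%N.
  by rewrite (leq_trans (rank_leq_col _)) // (faces_sz0 L0) cards1.
move: (\rank _) => r.
have -> : #|faces_sz (link D G) 1| = #|[set u | (u \notin G) && (u |: G \in D)]|.
  rewrite -[RHS](card_imset _ set1_inj); apply: eq_card => F; rewrite inE.
  apply/andP/imsetP => [[FL /cards1P[u Fu]]|[u]].
    exists u => //; move: FL; rewrite Fu (mem_link _ complex_closed) disjoints1 inE.
    by [].
  rewrite inE => uG ->; rewrite cards1 (mem_link _ complex_closed) disjoints1 uG.
  by [].
by case: r => [|[|r]] //; case: #|[set _ | _ ]| => [|[|[|m]]].
Qed.

(** The two facets on a ridge induce opposite signs on it. In characteristic 2 all coefficients are
    1 and the sum is 1 + 1. *)
Lemma orientation_cycle (K : fieldType) (f : {rmorphism k -> K}) o G :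
  oriented k D o -> G \in D -> #|G|.+1 = d ->
  bd D (fun F => (eps k o F)%:~R : K) G = 0.
Proof.
move=> oD GD Gd.
have /eqP/cards2P[u [v [uv E]]] := ridge_two_facets GD Gd.
have [uG uD] : u \notin G /\ u |: G \in D.
  by have := set21 u v; rewrite -E inE => /andP.
have [vG vD] : v \notin G /\ v |: G \in D.
  by have := set22 u v; rewrite -E inE => /andP.
rewrite /bd (eq_bigl (fun w => w \in [set u; v])) => [|w]; last by rewrite -E inE.
rewrite big_setU1 ?inE //= big_set1 /eps.
case: ifP => [c2|/negbT c2].
  have two0 : 2%:R = 0 :> K by rewrite -(rmorph_nat f) (pcharf0 c2) rmorph0.
  have sg1 m : (-1) ^+ m = 1 :> K.
    by rewrite -signr_odd; case: odd => //; apply/eqP; rewrite -subr_eq0 -opprD oppr_eq0 -two0.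
  by rewrite !sg1 !mul1r -two0.
have [perm ind] := oD c2.
have fac w : w \notin G -> w |: G \in D -> facet D (w |: G).
  by move=> wG wD; rewrite facetE wD cardsU1 wG add1n Gd eqxx.
have GE w : w \notin G -> (w |: G) :\ w = G by move=> wG; rewrite setU1K.
rewrite (seq_sign_induced (perm _ (fac u uG uD)) (setU11 _ _)).
rewrite (seq_sign_induced (perm _ (fac v vG vD)) (setU11 _ _)).
rewrite (ind _ _ u v (fac u uG uD) (fac v vG vD)) ?setU11 ?GE //; last first.
  by apply: contraNneq uv => /setP/(_ u); rewrite !inE eqxx (negbTE uG) !orbF => <-.
rewrite !below_setU1_self mulNr rmorphN /= !rmorphM /= !rmorph_sign.
by rewrite mulrN !(mulrCA ((-1) ^+ _)) -!expr2 !sqrr_sign !mulr1 addNr.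
Qed.

End Manifold.

(** * Minors indexed by faces *)

Section Minors.
Variables (n : nat) (K : comNzRingType).
Implicit Types (a : nat -> 'I_n -> K) (G F : {set 'I_n}) (p : 'I_n -> K).

(** Rows are indexed by [nat], so that dropping the first form is the shift [fun i => a i.+1]. As in
    [bracket], the sum selects the vertex of [G] in position [m]. *)
Definition colsmx a s G : 'M[K]_s :=
  \matrix_(i < s, m < s) \sum_(j in G | below G j == m) a i j.

Definition minor a s G : K := \det (colsmx a s G).

Lemma eq_minor a a' s G : (forall i j, (i < s)%N -> a i j = a' i j) ->
  minor a s G = minor a' s G.
Proof.
move=> h; congr (\det _); apply/matrixP => i m; rewrite !mxE.
by apply: eq_bigr => j _; apply: h.
Qed.

Lemma leq_below G u v : u \notin G -> v \in G ->
  (u < v)%N = (below G u <= below G v)%N.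
Proof.
move=> uG vG; case: ltnP => uv.
  apply/esym/subset_leq_card/subsetP => w; rewrite !inE => /andP[-> wu] /=.
  exact: ltn_trans wu uv.
have {}uv : (v < u)%N.
  rewrite ltn_neqAle uv andbT; apply: contraNneq uG => /val_inj <-; exact: vG.
apply/esym/negbTE; rewrite -ltnNge; apply/proper_card/properP; split.
  apply/subsetP => w; rewrite !inE => /andP[-> wv] /=; exact: ltn_trans wv uv.
by exists v; rewrite !inE vG ?ltnn ?uv.
Qed.

Lemma below_lt G u : u \in G -> (below G u < #|G|)%N.
Proof.
move=> uG; rewrite (cardsD1 u G) uG add1n ltnS; apply/subset_leq_card/subsetP => w.
by rewrite !inE => /andP[-> wu]; rewrite andbT; apply: contraTneq wu => ->; rewrite ltnn.
Qed.

Lemma below_le G u : (below G u <= #|G|)%N.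
Proof. by apply/subset_leq_card/subsetP => w; rewrite inE => /andP[]. Qed.

Lemma below_inj G : {in G &, injective (below G)}.
Proof.
have lt (u v : 'I_n) : u \in G -> (u < v)%N -> (below G u < below G v)%N.
  move=> uG uv; apply/proper_card/properP; split.
    by apply/subsetP => w; rewrite !inE => /andP[-> /ltn_trans ->].
  by exists u; rewrite !inE uG ?ltnn ?uv.
move=> u v uG vG E; apply/val_inj/eqP; case: ltngtP => // /lt.
  by move/(_ uG); rewrite E ltnn.
by move/(_ vG); rewrite E ltnn.
Qed.

Lemma below_sum a i G v : v \in G ->
  \sum_(j in G | below G j == below G v) a i j = a i v.
Proof.
move=> vG; rewrite (big_pred1 v) // => j /=.
apply/andP/eqP => [[jG /eqP /below_inj ->//]|->]; by rewrite vG.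
Qed.

(* The vector (cofac a s G i)_i represents, up to sign, the linear form
   c |-> det [a_G | c] on columns of height s + 1. *)
Definition cofac a s G (i : nat) : K :=
  (-1) ^+ i * minor (fun l => a (bump i l)) s G.

Lemma minor_expand a s G u : #|G| = s -> u \notin G ->
  minor a s.+1 (u |: G) * (-1) ^+ below G u = \sum_(i < s.+1) a i u * cofac a s G i.
Proof.
move=> Gs uG; have le : (below G u < s.+1)%N by rewrite ltnS -Gs below_le.
rewrite /minor (expand_det_col _ (Ordinal le)) big_distrl /=; apply: eq_bigr => i _.
have E : \sum_(j in u |: G | below (u |: G) j == below G u) a i j = a i u.
  by rewrite -(below_setU1_self G u) below_sum ?setU11.
rewrite mxE /= E {E}.
rewrite -mulrA; congr (_ * _); rewrite /cofac /cofactor /= exprD mulrAC.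
rewrite -[X in X * _]mulrA -expr2 sqrr_sign mulr1; congr (_ * \det _).
apply/matrixP => i' m; rewrite !mxE /=.
apply: eq_bigl => j; rewrite in_setU1; case: (eqVneq j u) => [->|ju] /=.
  rewrite (negbTE uG) below_setU1_self /=; apply/negbTE/eqP => E.
  by have := neq_bump (below G u) m; rewrite -E eqxx.
case: (boolP (j \in G)) => //= jG; rewrite below_setU1 // (leq_below uG jG).
by rewrite -[(_ + _)%N]/(bump (below G u) (below G j)) (can_eq (bumpK _)).
Qed.

(** Up to sign this is the determinant of the columns of [G] followed by the column of [w], which
    then occurs twice; [N] is the transpose of that matrix. *)
Lemma cofac_orth a s G w : #|G| = s -> w \in G ->
  \sum_(i < s.+1) a i w * cofac a s G i = 0.
Proof.
move=> Gs wG.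
pose N := \matrix_(m < s.+1, i < s.+1)
  (if (m < s)%N then \sum_(j in G | below G j == m) a i j else a i w).
have lt : (below G w < s.+1)%N by rewrite ltnS -Gs below_le.
have lt' : (below G w < s)%N by rewrite -Gs below_lt.
have : \det N = 0.
  apply: (determinant_alternate (i1 := Ordinal lt) (i2 := ord_max)).
    by apply/eqP => /(congr1 val) /= E; rewrite E ltnn in lt'.
  by move=> i; rewrite !mxE /= lt' ltnn below_sum.
rewrite (expand_det_row _ ord_max) => E.
have : \sum_(i < s.+1) N ord_max i * cofactor N ord_max i =
       (-1) ^+ s * \sum_(i < s.+1) a i w * cofac a s G i.
  rewrite big_distrr; apply: eq_bigr => i _ /=.
  rewrite [RHS]mulrCA mxE ltnn /cofac /cofactor exprD -mulrA; congr (_ * (_ * (_ * _))).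
  rewrite /minor -det_tr; congr (\det _).
  apply/matrixP => i' m; rewrite !mxE /=; have ms : (m < s)%N := ltn_ord m.
  by rewrite /(bump s) [(s <= m)%N]leqNgt ms add0n ms.
rewrite E => /(congr1 ( *%R ((-1) ^+ s))).
by rewrite mulr0 mulrA -expr2 sqrr_sign mul1r.
Qed.

Definition theta_at a l p : K := \sum_j a l j * p j.

(** Elimination: this combination of the forms [theta_at a i] contains no coordinate in [G], and its
    other coefficients are signed minors of the sets [u |: G]. It is what turns linear relations
    into boundary formulas. *)
Lemma cofac_theta a s G p : #|G| = s ->
  \sum_(i < s.+1) cofac a s G i * theta_at a i p =
  \sum_(u | u \notin G) (-1) ^+ below G u * minor a s.+1 (u |: G) * p u.
Proof.
move=> Gs; under eq_bigr => i _ do rewrite big_distrr /=.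
rewrite exchange_big (bigID (mem G)) /= big1 ?add0r => [|w wG]; last first.
  rewrite (eq_bigr (fun i : 'I_s.+1 => p w * (a i w * cofac a s G i))) => [|i _]; last by ring.
  by rewrite -big_distrr /= (cofac_orth _ Gs wG) mulr0.
apply: eq_bigr => u uG; rewrite [X in _ = X * _]mulrC minor_expand // big_distrl.
by apply: eq_bigr => i _; rewrite mulrCA mulrA.
Qed.

Lemma cofac_max a s G : cofac a s G s = (-1) ^+ s * minor a s G.
Proof.
congr (_ * _); apply: eq_minor => i j si.
by rewrite /bump leqNgt si.
Qed.

Lemma cofac0 a s G : cofac a s G 0 = minor (fun l => a l.+1) s G.
Proof. by rewrite /cofac expr0 mul1r; apply: eq_minor. Qed.

End Minors.

Lemma minor_map n (R S : comNzRingType) (f : {rmorphism R -> S}) (a : nat -> 'I_n -> R) s G :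
  f (minor a s G) = minor (fun i j => f (a i j)) s G.
Proof.
rewrite /minor -det_map_mx; congr (\det _); apply/matrixP => i m.
by rewrite !mxE rmorph_sum.
Qed.

Section Solve.
Variables (n : nat) (K : fieldType) (a : nat -> 'I_n -> K).
Implicit Types (G F : {set 'I_n}).

Lemma solve_cols s G (c : nat -> K) : #|G| = s -> minor a s G != 0 ->
  exists p : 'I_n -> K, (forall j, j \notin G -> p j = 0) /\
    forall l, (l < s)%N -> theta_at a l p = c l.
Proof.
move=> Gs m0; have U : colsmx a s G \in unitmx by rewrite unitmxE unitfE.
pose x := invmx (colsmx a s G) *m (\col_(i < s) c i).
exists (fun j => if j \in G then \sum_(m < s | m == below G j :> nat) x m 0 else 0).
split=> [j /negbTE -> //|l ls].
have : (colsmx a s G *m x) (Ordinal ls) 0 = c l by rewrite mulKVmx // mxE.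
rewrite mxE => <-; rewrite /theta_at (bigID (mem G)) /= [X in _ + X]big1 ?addr0; last first.
  by move=> j /negbTE ->; rewrite mulr0.
under eq_bigr => j jG do rewrite jG big_distrr /=.
rewrite (exchange_big_dep xpredT) //=; apply: eq_bigr => m _.
rewrite [colsmx _ _ _ _ _]mxE big_distrl /=; apply: eq_bigl => j.
by rewrite eq_sym.
Qed.

Lemma dual_cols s G v : #|G| = s -> v \in G -> minor a s G != 0 ->
  exists c : nat -> K, forall w, w \in G -> \sum_(l < s) c l * a l w = (w == v)%:R.
Proof.
case: s => [/cards0_eq ->|s Gs vG m0]; first by rewrite inE.
have Gv : #|G :\ v| = s by move: Gs; rewrite (cardsD1 v) vG => -[].
have vG' : v \notin G :\ v by rewrite !inE eqxx.
exists (fun l => (minor a s.+1 G * (-1) ^+ below (G :\ v) v)^-1 * cofac a s (G :\ v) l).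
move=> w wG; under eq_bigr => l _ do rewrite -mulrA [X in _ * X]mulrC.
rewrite -big_distrr /=; case: (eqVneq w v) => [->|wv].
  by rewrite -minor_expand // setD1K // mulVf // mulf_neq0 ?signr_eq0.
by rewrite cofac_orth ?mulr0 // !inE wv.
Qed.

End Solve.

(** * Polynomial functions with a degree bound *)

Section PolyFun.
Variables (n : nat) (K : fieldType).
Implicit Types (f g h l : ('I_n -> K) -> K) (x u : 'I_n -> K) (G : {set 'I_n}).

(* Polynomial functions of degree < N; the shift makes N = 0 the zero function. *)
Definition polyfun N f :=
  exists2 p : {mpoly K[n]}, (msize p <= N)%N & forall x, f x = p.@[x].

Lemma polyfun0 N : polyfun N (fun=> 0).
Proof. by exists 0; rewrite ?msize0 // => x; rewrite meval0. Qed.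

Lemma polyfun_lin N a f g : polyfun N f -> polyfun N g ->
  polyfun N (fun x => f x + a * g x).
Proof.
move=> [p pN fp] [q qN gq]; exists (p + a *: q) => [|x]; last first.
  by rewrite mevalD mevalZ fp gq.
by rewrite (leq_trans (msizeD_le _ _)) // geq_max pN (leq_trans (msizeZ_le _ _)).
Qed.

Lemma eq_polyfun N f g : (forall x, f x = g x) -> polyfun N f -> polyfun N g.
Proof. by move=> fg [p pN fp]; exists p => // x; rewrite -fg. Qed.

Lemma polyfun_sum (I : Type) (r : seq I) (P : pred I) N (F : I -> ('I_n -> K) -> K) :
  (forall i, P i -> polyfun N (F i)) -> polyfun N (fun x => \sum_(i <- r | P i) F i x).
Proof.
move=> h; elim: r => [|i r IH].
  by apply: eq_polyfun (polyfun0 N) => x; rewrite big_nil.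
case Pi: (P i); last by apply: eq_polyfun IH => x; rewrite big_cons Pi.
apply: eq_polyfun (polyfun_lin 1 (h i Pi) IH) => x.
by rewrite big_cons Pi mul1r.
Qed.

Lemma polyfun_le N N' f : (N <= N')%N -> polyfun N f -> polyfun N' f.
Proof. by move=> le [p pN fp]; exists p => //; apply: leq_trans pN le. Qed.

Lemma polyfun_const N c : polyfun N.+1 (fun=> c).
Proof.
exists c%:MP => [|x]; last by rewrite mevalC.
by rewrite msizeC; case: eqP.
Qed.

Lemma polyfun_coord j : polyfun 2 (fun x => x j).
Proof. by exists 'X_j => [|x]; rewrite ?msizeX ?mdeg1 // mevalXU. Qed.

Lemma polyfun_mul_aff N l f : polyfun 2 l -> polyfun N f -> polyfun N.+1 (fun x => l x * f x).
Proof.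
move=> [p p2 lp] [q qN fq]; exists (p * q) => [|x]; last by rewrite mevalM lp fq.
have [->|p0] := eqVneq p 0; first by rewrite mul0r msize0.
have [->|q0] := eqVneq q 0; first by rewrite mulr0 msize0.
rewrite msizeM //; move: p2 qN; case: (msize p) => [|[|[|//]]] _ qN /=.
- by rewrite add0n (leq_trans (leq_pred _)) // leqW.
- by rewrite add0n leqW.
- by rewrite add1n.
Qed.

Lemma monomial_split (m : 'X_{1..n}) e : mdeg m = e.+1 ->
  exists j, exists2 m', mdeg m' = e & forall x, 'X_[K, m].@[x] = x j * 'X_[K, m'].@[x].
Proof.
move=> me; have /existsP[j mj] : [exists j, m j != 0%N].
  apply: contra_eqT me => /existsPn h; rewrite mdegE big1 // => j _.
  by apply/eqP; move: (h j); rewrite negbK.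
have le : (U_(j) <= m)%MM.
  by apply/mnm_lepP => i; rewrite mnm1E; case: eqP => // <-; rewrite lt0n.
exists j, (m - U_(j))%MM.
  by have := mdegD (m - U_(j)) U_(j); rewrite submK // me mdeg1 addn1 => -[].
by move=> x; rewrite -{1}(submK le) mpolyXD mevalM mevalXU mulrC.
Qed.

Lemma meval_monomial0 x (m : 'X_{1..n}) : mdeg m = 0%N -> 'X_[K, m].@[x] = 1.
Proof. by move/eqP; rewrite mdeg_eq0 => /eqP ->; rewrite mpolyX0 meval1. Qed.

Lemma polyfun_monomials (P : (('I_n -> K) -> K) -> Prop) N f :
  (forall f g, (forall x, f x = g x) -> P f -> P g) -> P (fun=> 0) ->
  (forall a f g, P f -> P g -> P (fun x => f x + a * g x)) ->
  (forall m : 'X_{1..n}, (mdeg m < N)%N -> P (fun x => 'X_[K, m].@[x])) ->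
  polyfun N f -> P f.
Proof.
move=> ext P0 Plin Pm [p pN fp].
apply: (ext (fun x => p.@[x])) => [x|]; first by rewrite fp.
have sub m : m \in msupp p -> (mdeg m < N)%N.
  by move/msize_mdeg_lt => h; apply: leq_trans h pN.
rewrite [p]mpolyE; elim: (msupp p) sub => [|m r IH] sub.
  by apply: ext P0 => x; rewrite big_nil meval0.
apply: ext (Plin p@_m _ _ (IH _) (Pm m (sub m (mem_head _ _)))) => [x|m' m'r].
  by rewrite big_cons mevalD mevalZ addrC.
by apply: sub; rewrite inE m'r orbT.
Qed.

(* If l(x + u) = l(x) + 1, then x - l(x) u is the projection of x onto l = 0, so
   a polynomial vanishing on l = 0 is divisible by l, with the expected degree. *)
Lemma polyfun_div N l f u : polyfun 2 l -> polyfun N f ->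
  exists2 h, polyfun N.-1 h &
    forall x, f x - f (fun j => x j - l x * u j) = l x * h x.
Proof.
move=> l2; pose y x := fun j => x j - l x * u j.
apply: (@polyfun_monomials (fun f => exists2 h, polyfun N.-1 h &
    forall x, f x - f (y x) = l x * h x)).
- by move=> f1 f2 E [h hN H]; exists h => // x; rewrite -!E.
- by exists (fun=> 0) => [|x]; rewrite ?subrr ?mulr0 //; apply: polyfun0.
- move=> a f1 f2 [h1 h1N H1] [h2 h2N H2]; exists (fun x => h1 x + a * h2 x).
    exact: polyfun_lin.
  by move=> x; rewrite mulrDr -H1 mulrCA -H2; ring.
move=> m mN.
suff [_ [h hm H]] : polyfun (mdeg m).+1 (fun x => 'X_[K, m].@[y x]) /\
   exists2 h, polyfun (mdeg m) h &
     forall x, 'X_[K, m].@[x] - 'X_[K, m].@[y x] = l x * h x.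
  by exists h => //; apply: polyfun_le hm; case: N mN.
move: {2 3 4}(mdeg m) (erefl (mdeg m)) => e; elim: e m {mN} => [|e IH] m me.
  split; first by apply: eq_polyfun (polyfun_const 0 1) => x; rewrite meval_monomial0.
  by exists (fun=> 0) => [|x]; rewrite ?meval_monomial0 // ?subrr ?mulr0 //; apply: polyfun0.
have [j [m' m'e E]] := monomial_split me.
have [P1 [h h1 H]] := IH _ m'e.
have yj : polyfun 2 (fun x => y x j).
  apply: eq_polyfun (polyfun_lin (- u j) (polyfun_coord j) l2) => x.
  by rewrite /y mulNr mulrC.
split; first by apply: eq_polyfun (polyfun_mul_aff yj P1) => x; rewrite E.
exists (fun x => x j * h x + u j * 'X_[K, m'].@[y x]).
  by apply: polyfun_lin => //; apply: polyfun_mul_aff => //; apply: polyfun_coord.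
move=> x; rewrite !E mulrDr mulrCA -H /y; ring.
Qed.

Hypothesis inf : exists e : nat -> K, injective e.

Lemma poly_inf_roots (q : {poly K}) : (forall t, q.[t] = 0) -> q = 0.
Proof.
move=> h; have [e einj] := inf; apply/eqP; apply/negPn/negP => q0.
have := max_poly_roots (rs := map e (iota 0 (size q))) q0.
rewrite size_map size_iota ltnn map_inj_uniq ?iota_uniq // => H.
suff /H/(_ isT) : all (root q) (map e (iota 0 (size q))) by [].
by apply/allP => t _; rewrite /root h.
Qed.

Lemma meval_line (p : {mpoly K[n]}) x u :
  exists q : {poly K}, forall t, q.[t] = p.@[fun j => x j + t * u j].
Proof.
exists (\sum_(m <- msupp p) p@_m *: \prod_i ((x i)%:P + u i *: 'X) ^+ m i) => t.
rewrite mevalE horner_sum; apply: eq_bigr => m _.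
rewrite hornerZ horner_prod; congr (_ * _); apply: eq_bigr => i _.
by rewrite horner_exp hornerD hornerC hornerZ hornerX mulrC.
Qed.

Lemma polyfun_line0 N f x u : polyfun N f ->
  (forall t, t != 0 -> f (fun j => x j + t * u j) = 0) -> f x = 0.
Proof.
move=> [p _ fp] h; have [q hq] := meval_line p x u.
(* The factor ['X] covers [t = 0], where nothing is assumed; it is cancelled afterwards. *)
have : q * 'X = 0.
  apply: poly_inf_roots => t; rewrite hornerM hornerX hq -fp.
  by have [->|t0] := eqVneq t 0; rewrite ?mulr0 // h // mul0r.
move/eqP; rewrite mulf_eq0 polyX_eq0 orbF => /eqP q0.
rewrite fp; have := hq 0; rewrite q0 horner0 => ->.
by apply: meval_eq => j; rewrite mul0r addr0.
Qed.

Definition msup (m : 'X_{1..n}) : {set 'I_n} := [set j | m j != 0%N].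

Lemma meval_monomial_supp x m : ~~ (msup m \subset [set j | x j != 0]) ->
  'X_[K, m].@[x] = 0.
Proof.
case/subsetPn => j; rewrite !inE negbK => mj /eqP xj.
by rewrite mevalX (bigD1 j) //= xj expr0n (negbTE mj) mul0r.
Qed.

Lemma digits_inj N r (b b' : 'I_r -> nat) :
  (forall i, b i < N)%N -> (forall i, b' i < N)%N ->
  (\sum_i b i * N ^ i = \sum_i b' i * N ^ i)%N -> b =1 b'.
Proof.
elim: r b b' => [b b' _ _ _ []//|r IH b b' bN b'N].
have N0 : (0 < N)%N by apply: leq_ltn_trans (bN ord0).
rewrite !big_ord_recl !expn0 !muln1.
have E (c : 'I_r.+1 -> nat) : (\sum_(i < r) c (lift ord0 i) * N ^ (lift ord0 i) =
   (\sum_(i < r) c (lift ord0 i) * N ^ i) * N)%N.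
  by rewrite big_distrl; apply: eq_bigr => i _ /=; rewrite /bump add1n expnSr mulnA.
rewrite !E => H; have H0 : b ord0 = b' ord0.
  have := congr1 (modn^~ N) H.
  by rewrite !(addnC (_ ord0)) !modnMDl !modn_small.
move: H; rewrite H0 => /addnI/eqP; rewrite eqn_pmul2r // => /eqP/IH H1 i.
case: (unliftP ord0 i) => [j ->|->//].
exact: H1.
Qed.

(* Kronecker substitution x_j = y^(N^j). *)
Lemma mcoeff_eq0_on G (p : {mpoly K[n]}) m :
  (forall x, (forall j, j \notin G -> x j = 0) -> p.@[x] = 0) ->
  msup m \subset G -> p@_m = 0.
Proof.
move=> van mG; have [mp|] := boolP (m \in msupp p); last by move/memN_msupp_eq0.
pose N := msize p; pose w (m : 'X_{1..n}) := (\sum_j m j * N ^ j)%N.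
pose q : {poly K} := \sum_(m <- msupp p | msup m \subset G) p@_m *: 'X^(w m).
have q0 : q = 0.
  apply: poly_inf_roots => t.
  pose x j := if j \in G then t ^+ (N ^ j) else 0.
  rewrite -(van x) => [|j /negbTE jG]; last by rewrite /x jG.
  rewrite mevalE /q horner_sum [RHS](bigID (fun m => msup m \subset G)) /=.
  rewrite [X in _ + X]big1 ?addr0 => [|m' m'G]; last first.
    rewrite -mevalX meval_monomial_supp ?mulr0 //.
    apply: contra m'G => /subset_trans; apply; apply/subsetP => j.
    by rewrite inE /x; case: ifP; rewrite ?eqxx.
  apply: eq_bigr => m' m'G; rewrite hornerZ hornerXn; congr (_ * _).
  rewrite /w -prodrXr; apply: eq_bigr => j _; rewrite /x.
  case: ifP => [jG|/negbT jG]; first by rewrite mulnC exprM.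
  by have -> : m' j = 0%N by apply: contraNeq jG => mj; apply: (subsetP m'G); rewrite inE.
have lt m' j : m' \in msupp p -> (m' j < N)%N.
  move=> /msize_mdeg_lt; apply: leq_trans; rewrite ltnS mdegE (bigD1 j) //=.
  exact: leq_addr.
have := congr1 (fun q : {poly K} => q`_(w m)) q0.
rewrite coef0 /q coef_sum big_mkcond (bigD1_seq m) //= mG coefZ coefXn eqxx mulr1.
rewrite big_seq_cond big1 ?addr0 // => m' /andP[m'p m'm].
case: ifP => // _; rewrite coefZ coefXn.
case: eqP => [E|]; last by rewrite mulr0.
by case/eqP: m'm; apply/mnmP; apply: (@digits_inj N) => [j|j|]; rewrite ?lt //.
Qed.

End PolyFun.

(** * Gluing polynomials on the star of a vertex *)

Section Gluing.
Variables (n d : nat) (K : fieldType) (D : {set {set 'I_n}}).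
Variables (a : nat -> 'I_n -> K) (e : {set 'I_n} -> K) (v : 'I_n).
Implicit Types (F G H U : {set 'I_n}) (x u : 'I_n -> K) (N s i : nat).
Implicit Types (ga xi : {set 'I_n} -> ('I_n -> K) -> K).
Hypotheses (inf : exists f : nat -> K, injective f) (clD : closed_down D).
Hypothesis exact : forall U s (c : {set 'I_n} -> K), U \in D -> v \in U ->
  (#|U| <= s)%N -> (s < d)%N ->
  (forall G, G \in D -> U \subset G -> #|G|.+1 = s -> bd D c G = 0) ->
  exists c', forall G, G \in D -> U \subset G -> #|G| = s -> c G = bd D c' G.
Hypothesis top : forall U (c : {set 'I_n} -> K), U \in D -> v \in U ->
  (forall G, G \in D -> U \subset G -> #|G|.+1 = d -> bd D c G = 0) ->
  exists t, forall G, G \in D -> U \subset G -> #|G| = d -> c G = t * e G.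
Hypothesis minor_neq0 : forall G, G \in D -> minor a #|G| G != 0.
Hypothesis minorS_neq0 : forall G, G \in D -> (#|G| < d)%N ->
  minor (fun i => a i.+1) #|G| G != 0.

(* slice i G is the affine subspace of K^G cut out by theta_0 = 1 and
   theta_l = 0 for 0 < l < i; it is a point when i = #|G|. *)
Definition lam i x := theta_at a i x - (i == 0%N)%:R.

Definition slice i G x :=
  (forall j, j \notin G -> x j = 0) /\ (forall l, (l < i)%N -> lam l x = 0).

Lemma theta_line l x u t :
  theta_at a l (fun j => x j + t * u j) = theta_at a l x + t * theta_at a l u.
Proof.
rewrite /theta_at mulr_sumr -big_split; apply: eq_bigr => j _ /=.
by rewrite mulrDr mulrCA.
Qed.

Lemma lam_line l x u t : lam l (fun j => x j + t * u j) = lam l x + t * theta_at a l u.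
Proof. by rewrite /lam theta_line addrAC. Qed.

Lemma polyfun_lam i : polyfun 2 (lam i).
Proof.
apply: eq_polyfun (polyfun_lin (-1) (polyfun_sum (index_enum _) (P := xpredT)
  (F := fun j x => 0 + a i j * x j) _) (polyfun_const n 1 (i == 0%N)%:R)).
  move=> x; rewrite mulN1r; congr (_ - _).
  by apply: eq_bigr => j _; rewrite add0r.
by move=> j _; apply: polyfun_lin; [exact: polyfun0|exact: polyfun_coord].
Qed.

Lemma slice_sub i G H x : G \subset H -> slice i G x -> slice i H x.
Proof.
by move=> GH [h1 h2]; split=> // j jH; apply: h1; apply: contra jH; apply: subsetP.
Qed.

Lemma slice_pred i G x : slice i.+1 G x -> slice i G x /\ lam i x = 0.
Proof. by case=> h1 h2; split; [split=> // l li; apply: h2; rewrite ltnS ltnW|apply: h2]. Qed.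

(** On a vector supported in [G] the right side of [cofac_theta] vanishes. On the left only two
    forms survive, the one of index 0 with value 1 and the one of index [#|G|], so the latter is a
    quotient of minors. For empty [G] only the constant in [lam] remains. *)
Lemma lam_minor G x : slice #|G| G x ->
  lam #|G| x * ((-1) ^+ #|G| * minor a #|G| G) = - minor (fun i => a i.+1) #|G| G.
Proof.
case=> xG xl; rewrite -cofac_max.
have := cofac_theta a x (erefl #|G|).
rewrite [RHS]big1 => [|u uG]; last by rewrite xG ?mulr0.
rewrite big_ord_recr /= => E.
have := cofac0 a #|G| G => <-; move/eqP: E; rewrite addrC addr_eq0 => /eqP E.
rewrite /lam mulrBl (mulrC (theta_at _ _ _)) E -opprD; congr (- _).
have T l : (l < #|G|)%N -> theta_at a l x = (l == 0%N)%:R.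
  by move=> lG; apply/eqP; rewrite -subr_eq0; apply/eqP/xl.
case: #|G| T {E xl xG} => [|s] T; first by rewrite big_ord0 add0r mul1r.
rewrite big_ord_recl /= T // mulr1 big1 ?addr0 ?mul0r ?addr0 // => l _.
by rewrite T ?mulr0 // /bump add1n ltnS.
Qed.

Lemma lam_neq0 i G x : G \in D -> #|G| = i -> (i < d)%N -> slice i G x -> lam i x != 0.
Proof.
move=> GD <- Gd /lam_minor; apply: contra_eq_neq => ->.
by rewrite mul0r eq_sym oppr_eq0 minorS_neq0.
Qed.

Lemma direction i G : G \in D -> (i < #|G|)%N ->
  exists u, [/\ forall j, j \notin G -> u j = 0, forall l, (l < i)%N -> theta_at a l u = 0
    & theta_at a i u = 1].
Proof.
move=> GD iG; have [u [uG ul]] := solve_cols (fun l => (l == i)%:R) (erefl #|G|) (minor_neq0 GD).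
exists u; split=> // [l li|]; last by rewrite ul ?eqxx.
by rewrite ul ?ltn_eqF // (ltn_trans li).
Qed.

(** Moving along a direction [u] on which the form of index [i] is 1 projects [slice i G] onto
    [slice i.+1 G], where [f] vanishes; the quotient from [polyfun_div] therefore serves. *)
Lemma slice_div i G N f : G \in D -> (i < #|G|)%N -> polyfun N f ->
  (forall x, slice i.+1 G x -> f x = 0) ->
  exists2 h, polyfun N.-1 h & forall x, slice i G x -> f x = lam i x * h x.
Proof.
move=> GD iG fN f0; have [u [uG ul ui]] := direction GD iG.
have [h hN hE] := polyfun_div u (polyfun_lam i) fN.
exists h => // x [xG xl]; rewrite -hE.
have -> : f (fun j => x j - lam i x * u j) = f (fun j => x j + (- lam i x) * u j).
  by case: fN => p _ fp; rewrite !fp; apply: meval_eq => j; rewrite mulNr.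
rewrite [X in _ - X]f0 ?subr0 //; split=> [j jG|l].
  by rewrite xG // uG // mulr0 addr0.
rewrite lam_line ltnS leq_eqVlt => /predU1P[->|li]; first by rewrite ui mulr1 subrr.
by rewrite xl // ul // mulr0 addr0.
Qed.

(** Either [i = #|G|] and [lam i] is nonzero on the slice by [lam_neq0], or a zero of [lam i] lies
    on a line in the slice along which [lam i], hence not [f], is nonzero at all other points. *)
Lemma slice_cancel i G N f : G \in D -> (i <= #|G|)%N -> (i < d)%N -> polyfun N f ->
  (forall x, slice i G x -> lam i x * f x = 0) ->
  forall x, slice i G x -> f x = 0.
Proof.
move=> GD; rewrite leq_eqVlt => /predU1P[iE|iG] id fN f0 x xV.
  have := f0 x xV; move/eqP; rewrite mulf_eq0 => /orP[|/eqP //].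
  by rewrite (negbTE (lam_neq0 GD (esym iE) id xV)).
have [l0|l0] := eqVneq (lam i x) 0; last first.
  by have /eqP := f0 x xV; rewrite mulf_eq0 (negbTE l0) => /eqP.
have [u [uG ul ui]] := direction GD iG.
apply: (polyfun_line0 inf (u := u) fN) => t t0; have /f0/eqP : slice i G (fun j => x j + t * u j).
  case: xV => xG xl; split=> [j jG|l li]; first by rewrite xG // uG // mulr0 addr0.
  by rewrite lam_line xl // ul // mulr0 addr0.
by rewrite mulf_eq0 lam_line l0 ui mulr1 add0r (negbTE t0) => /eqP.
Qed.

Definition bdf ga G x := bd D (fun F => ga F x) G.

Lemma polyfun_bdf N ga G : (forall F, polyfun N (ga F)) -> polyfun N (bdf ga G).
Proof.
move=> gN; apply: (@eq_polyfun _ _ N (fun x => \sum_(u | (u \notin G) && (u |: G \in D))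
    (0 + (-1) ^+ below G u * ga (u |: G) x))).
  by move=> x; apply: eq_bigr => u _; rewrite add0r.
by apply: polyfun_sum => u _; apply: polyfun_lin => //; apply: polyfun0.
Qed.

Definition cycle_on s i ga := forall G, G \in D -> v \in G -> #|G|.+1 = s ->
  forall x, slice i G x -> bdf ga G x = 0.

(** In size [d] the complex is continued by the global polynomials [f], sent to the chain [f * e];
    bounding there means being glued from one polynomial. *)
Definition bounds s N i ga :=
  if (s < d)%N then
    exists2 xi, forall F, polyfun N (xi F) &
      forall G, G \in D -> v \in G -> #|G| = s -> forall x, slice i G x -> ga G x = bdf xi G x
  else exists2 f, polyfun N f &
      forall G, G \in D -> v \in G -> #|G| = s -> forall x, slice i G x -> ga G x = f x * e G.

(* The polynomials of degree < N on the slices of the faces containing v form an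
   exact complex in sizes > i. *)
Definition exact_on i := forall s N ga, (i < s)%N -> (s <= d)%N ->
  (forall F, polyfun N (ga F)) -> cycle_on s i ga -> bounds s N i ga.

Lemma bounds_le s N i ga ga' : bounds s N i ga' ->
  (forall G, #|G| = s -> forall x, slice i.+1 G x -> ga G x = ga' G x) ->
  bounds s N i.+1 ga.
Proof.
rewrite /bounds => + E; case: ifP => _ [f fN H]; exists f => // G GD vG Gs x xV;
  by rewrite E //; apply: H => //; case: (slice_pred xV).
Qed.

(* Level 0 splits into the monomials m, whose coefficients form chains on the
   faces containing supp m and v, i.e. on the link of a nonempty face. *)
Lemma exact_on0 : exact_on 0.
Proof.
move=> s N ga s0 sd gaN cyc.
have [P [PN PE]] : exists P : {set 'I_n} -> {mpoly K[n]},
    (forall F, msize (P F) <= N)%N /\ forall F x, ga F x = (P F).@[x].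
  have [P HP] := fin_all_exists2 (P := fun F (p : {mpoly K[n]}) => (msize p <= N)%N)
    (Q := fun F p => forall x, ga F x = p.@[x]) (fun F => gaN F).
  by move=> PE; exists P.
pose U (m : 'X_{1..n}) := v |: msup m.
have vU m : v \in U m by rewrite setU11.
have slice0 G x : (forall j, j \notin G -> x j = 0) -> slice 0 G x by split.
have coef_cyc (m : 'X_{1..n}) G : G \in D -> U m \subset G -> #|G|.+1 = s ->
    bd D (fun F => (P F)@_m) G = 0.
  move=> GD UG Gs.
  pose Q := \sum_(u | (u \notin G) && (u |: G \in D)) (-1) ^+ below G u *: P (u |: G).
  have -> : bd D (fun F => (P F)@_m) G = Q@_m.
    by rewrite /Q /bd raddf_sum; apply: eq_bigr => u _ /=; rewrite mcoeffZ.
  apply: (@mcoeff_eq0_on _ _ inf G); last exact: subset_trans (subsetUr _ _) UG.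
  move=> x xG; rewrite -(cyc G GD (subsetP UG _ (vU m)) Gs x (slice0 _ _ xG)).
  rewrite /Q /bdf /bd raddf_sum; apply: eq_bigr => u _ /=.
  by rewrite mevalZ PE.
have UF m G x : v \in G -> (forall j, j \notin G -> x j = 0) -> ~~ (U m \subset G) ->
    'X_[K, m].@[x] = 0.
  move=> vG xG; rewrite subUset sub1set vG /= => mG; apply: meval_monomial_supp.
  apply: contra mG => /subset_trans; apply; apply/subsetP => j; rewrite inE.
  by apply: contraNT => /xG ->.
have polymon (c : 'X_{1..n < N} -> K) :
    polyfun N (fun x => \sum_(m : 'X_{1..n < N}) c m * 'X_[K, m].@[x]).
  apply: polyfun_sum => m _.
  apply: (@eq_polyfun _ _ N (fun x => 0 + c m * 'X_[K, m].@[x])) => [x|]; first by rewrite add0r.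
  apply: polyfun_lin; first exact: polyfun0.
  by exists 'X_[m] => [|//]; rewrite msizeX bmdeg.
have gaE F x : ga F x = \sum_(m : 'X_{1..n < N}) (P F)@_m * 'X_[K, m].@[x].
  rewrite PE {1}(mpolywE (PN F)) raddf_sum; apply: eq_bigr => m _ /=.
  by rewrite mevalZ.
rewrite /bounds; case: ltnP => sd'.
  have [C HC] : exists C : 'X_{1..n < N} -> {set 'I_n} -> K, forall (m : 'X_{1..n < N}) G,
      G \in D -> U m \subset G -> #|G| = s -> (P G)@_m = bd D (C m) G.
    apply: (fin_all_exists (P := fun (m : 'X_{1..n < N}) c => forall G,
      G \in D -> U m \subset G -> #|G| = s -> (P G)@_m = bd D c G)) => m.
    have [/andP[UD Us]|nU] := boolP ((U m \in D) && (#|U m| <= s)%N).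
      by apply: exact => // G GD UG Gs; apply: coef_cyc.
    exists (fun=> 0) => G GD UG Gs; case/negP: nU.
    by rewrite (clD GD UG) -Gs subset_leq_card.
  exists (fun G x => \sum_(m : 'X_{1..n < N}) C m G * 'X_[K, m].@[x]) => [F|G GD vG Gs x [xG _]].
    exact: polymon.
  rewrite gaE /bdf /bd; under [RHS]eq_bigr => u _ do rewrite big_distrr /=.
  rewrite exchange_big; apply: eq_bigr => m _ /=.
  have [UG|UG] := boolP (U m \subset G).
    by rewrite (HC m) // /bd big_distrl; apply: eq_bigr => u _; rewrite mulrA.
  by rewrite (UF m G) // mulr0 big1 // => u _; rewrite mulr0 mulr0.
have {sd sd'} sd : s = d by apply/eqP; rewrite eqn_leq sd.
have [t Ht] : exists t : 'X_{1..n < N} -> K, forall (m : 'X_{1..n < N}) G,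
    G \in D -> U m \subset G -> #|G| = s -> (P G)@_m = t m * e G.
  apply: (fin_all_exists (P := fun (m : 'X_{1..n < N}) t => forall G,
    G \in D -> U m \subset G -> #|G| = s -> (P G)@_m = t * e G)) => m.
  have [UD|nU] := boolP (U m \in D).
    by rewrite sd; apply: top => // G GD UG Gs; apply: coef_cyc; rewrite ?sd.
  by exists 0 => G GD UG Gs; case/negP: nU; apply: clD UG.
exists (fun x => \sum_(m : 'X_{1..n < N}) t m * 'X_[K, m].@[x]); first exact: polymon.
move=> G GD vG Gs x [xG _]; rewrite gaE big_distrl; apply: eq_bigr => m _ /=.
have [UG|UG] := boolP (U m \subset G); first by rewrite (Ht m) // mulrAC.
by rewrite (UF m G) // !mulr0 mul0r.
Qed.

Lemma bdf_lin (t : ('I_n -> K) -> K) ga xi G x :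
  bdf (fun F x => ga F x + t x * xi F x) G x = bdf ga G x + t x * bdf xi G x.
Proof. exact: bd_lin. Qed.

(** For [N > 0] multiplication by [lam] restores the degree lost in [N.-1]. For [N = 0] the
    predecessor loses nothing, and the last assumption on [xi] takes over. *)
Lemma polyfun_sub_lam N i ga xi : (forall F, polyfun N (ga F)) ->
  (forall F, polyfun N.-1 (xi F)) -> (N = 0%N -> forall F x, xi F x = 0) ->
  forall F, polyfun N (fun x => ga F x + (- lam i x) * xi F x).
Proof.
case: N => [|N] gaN xiN xi0 F.
  by apply: eq_polyfun (gaN F) => x; rewrite xi0 // mulr0 addr0.
apply: eq_polyfun (polyfun_lin (-1) (gaN F) (polyfun_mul_aff (polyfun_lam i) (xiN F))) => x.
by rewrite mulN1r mulNr.
Qed.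

Lemma polyfun_eq0 f x : polyfun 0 f -> f x = 0.
Proof.
by case=> p; rewrite leqn0 msize_poly_eq0 => /eqP -> ->; rewrite meval0.
Qed.

(* A cycle ga on the smaller slices has boundary lam * eta on the larger ones;
   eta is again a cycle, hence bounds some ze of smaller degree, and ga - lam * ze
   is a cycle on the larger slices. *)
Lemma exact_onS i : (i.+1 < d)%N -> exact_on i -> exact_on i.+1.
Proof.
move=> id Ei s N ga is_ sd gaN cyc.
have id' : (i < d)%N by apply: ltn_trans id.
have [eta etaN etaE] : exists2 eta, forall G, polyfun N.-1 (eta G) &
    forall G, [&& G \in D, v \in G & #|G|.+1 == s] ->
    forall x, slice i G x -> bdf ga G x = lam i x * eta G x.
  apply: (fin_all_exists2 (P := fun G h => polyfun N.-1 h) (Q := fun G h =>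
    [&& G \in D, v \in G & #|G|.+1 == s] ->
    forall x, slice i G x -> bdf ga G x = lam i x * h x)) => G.
  have [/and3P[GD vG /eqP Gs]|] := boolP [&& G \in D, v \in G & #|G|.+1 == s]; last first.
    by exists (fun=> 0); [exact: polyfun0|].
  have iG : (i < #|G|)%N by rewrite -ltnS Gs.
  have [h hN hE] := slice_div GD iG (polyfun_bdf G gaN) (cyc G GD vG Gs).
  by exists h.
have [s0 sE] : exists s0, s = s0.+1 by case: s is_ {sd cyc etaE} => // s0; exists s0.
have etacyc : cycle_on s0 i eta.
  move=> G GD vG Gs; apply: (slice_cancel GD _ id' (polyfun_bdf G etaN)).
    by rewrite -ltnS Gs -ltnS -sE.
  (* Here [lam] times the boundary of [eta] is the double boundary of [ga], hence zero, and
     [slice_cancel] removes [lam]. *)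
  move=> x xV; rewrite -(bd_bd (fun F => ga F x) G clD) /bdf /bd big_distrr.
  apply: eq_bigr => u /andP[uG uD] /=; rewrite mulrCA; congr (_ * _).
  rewrite -[RHS]/(bdf ga _ _) etaE // ?uD ?cardsU1 ?uG ?Gs ?sE ?add1n ?Gs ?eqxx ?setU1r //.
  exact: slice_sub (subsetUr _ _) xV.
have := Ei s0 N.-1 eta _ _ etaN etacyc; rewrite /bounds.
have s0d : (s0 < d)%N by rewrite -sE.
rewrite s0d => /(_ _ (ltnW s0d)) [|ze zeN zeE]; first by rewrite -ltnS -sE.
have ze0 : N = 0%N -> forall F x, ze F x = 0.
  by move=> N0 F x; apply: polyfun_eq0; have := zeN F; rewrite N0.
apply: (bounds_le (ga' := fun F x => ga F x + (- lam i x) * ze F x)).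
  apply: Ei => //; first exact: ltnW.
    exact: polyfun_sub_lam.
  move=> G GD vG Gs x xV; rewrite bdf_lin etaE ?GD ?vG ?Gs ?eqxx // zeE //.
    by rewrite mulNr subrr.
  by apply/eqP; rewrite -eqSS Gs sE.
by move=> G Gs x xV; have [_ ->] := slice_pred xV; rewrite oppr0 mul0r addr0.
Qed.

Lemma exact_on_lt i : (i < d)%N -> exact_on i.
Proof.
elim: i => [|i IH] id; first exact: exact_on0.
by apply: exact_onS => //; apply: IH; apply: ltnW.
Qed.

(* On faces of size i + 1 the slice is a point, so c is a family of constants;
   the obstruction to extending it to polynomials is lowered by one degree at the
   cost of passing to faces of size i. *)
Lemma bounds_descent i N (c c' : {set 'I_n} -> K) : (i < d)%N ->
  (forall G, G \in D -> v \in G -> #|G| = i -> forall x, slice i G x ->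
    bd D c G = lam i x * c' G) ->
  bounds i N i (fun G _ => c' G) -> bounds i.+1 N.+1 i.+1 (fun G _ => c G).
Proof.
move=> id cE; rewrite {1}/bounds id => -[ze zeN zeE].
apply: (bounds_le (ga' := fun F x => c F + (- lam i x) * ze F x)).
  apply: (exact_on_lt id) => //.
    by apply: polyfun_sub_lam => // F; apply: polyfun_const.
  move=> G GD vG [Gs] x xV; rewrite (bdf_lin _ (fun F _ => c F)) /bdf (cE G GD vG Gs x xV).
  by rewrite -[bd D (fun F => ze F x) G]/(bdf ze G x) -zeE // mulNr subrr.
by move=> G Gs x xV; have [_ ->] := slice_pred xV; rewrite oppr0 mul0r addr0.
Qed.

Section Functional.
Variables (w g : {set 'I_n} -> K) (p : {set 'I_n} -> 'I_n -> K).
Hypothesis pV : forall F, F \in D -> #|F| = d -> slice d F (p F).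
Hypothesis we : forall F, F \in D -> #|F| = d ->
  minor a d F * (w F * \prod_(j in F) p F j) = e F.
Hypothesis e_neq0 : forall F, F \in D -> #|F| = d -> e F != 0.

Definition moment G : K :=
  \sum_(F in D | #|F| == d) w F * g F * \prod_(j in G) p F j.

(** At a point [p F] the left side of [cofac_theta] reduces to its term of index 0, where the form
    has value 1. The sets [u |: G] outside [D] contribute nothing, because [p F] is supported on the
    face [F]. *)
Lemma bd_moment G : G \in D -> (#|G| < d)%N ->
  bd D (fun F => minor a #|F| F * moment F) G =
  minor (fun i => a i.+1) #|G| G * moment G.
Proof.
move=> GD Gd; rewrite /bd /moment big_distrr.
under [LHS]eq_bigr => u _ do rewrite /= mulrA big_distrr /=.
rewrite exchange_big; apply: eq_bigr => F /andP[FD /eqP Fd] /=.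
have [pF pl] := pV FD Fd.
have [GF|/subsetPn[j jG jF]] := boolP (G \subset F); last first.
  have z H : j \in H -> \prod_(j in H) p F j = 0.
    by move=> jH; rewrite (bigD1 j) //= pF // mul0r.
  by rewrite z // !mulr0 big1 // => u _; rewrite z ?mulr0 // setU1r.
have := cofac_theta a (p F) (erefl #|G|).
rewrite big_ord_recl big1 /= => [|l _]; last first.
  have := pl (bump 0 l); rewrite /lam subr0 => ->; rewrite ?mulr0 //.
  by rewrite /bump add1n (leq_ltn_trans _ Gd).
have /eqP := pl 0%N (leq_ltn_trans (leq0n _) Gd); rewrite subr_eq0 => /eqP ->.
rewrite mulr1 addr0 cofac0 => ->.
rewrite big_distrl /= [RHS](bigID (fun j : 'I_n => j |: G \in D)) /= [X in _ + X]big1 ?addr0.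
  apply: eq_bigr => u /andP[uG uD].
  rewrite (big_setU1 _ uG) cardsU1 uG add1n /=; ring.
move=> u /andP[uG uD]; rewrite pF ?mulr0 ?mul0r //.
by apply: contra uD => uF; apply: clD FD _; rewrite subUset sub1set uF.
Qed.

(** The point of any other facet has a zero coordinate at some vertex of [F], so only the term of
    [F] itself remains. *)
Lemma moment_facet F : F \in D -> #|F| = d -> minor a #|F| F * moment F = g F * e F.
Proof.
move=> FD Fd; rewrite /moment (bigD1 F) /=; last by rewrite FD Fd eqxx.
rewrite [X in _ + X]big1 ?addr0; first by rewrite -(we FD Fd) Fd; ring.
move=> F' /andP[/andP[FD' /eqP Fd'] FF'].
have [j jF jF'] : exists2 j, j \in F & j \notin F'.
  apply/subsetPn; apply: contra FF' => sub.
  by rewrite eq_sym eqEcard sub Fd Fd' leqnn.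
have [pF' _] := pV FD' Fd'.
by rewrite (bigD1 j) //= pF' // mul0r mulr0.
Qed.

(** Climbs from size [i0], where the moments vanish, to size [d]. By [bd_moment] and [lam_minor],
    the boundary of the chain of minors times moments is, up to sign, [lam] times the same chain one
    size lower, so [bounds_descent] raises size and degree bound by one. In size [d] the chain is
    [g F * e F]. *)
Lemma moment_interpolation i0 : (i0 < d)%N ->
  (forall G, G \in D -> v \in G -> #|G| = i0 -> moment G = 0) ->
  exists2 f, polyfun (d - i0) f &
    forall F, F \in D -> v \in F -> #|F| = d -> g F = f (p F).
Proof.
move=> i0d m0.
have H j : (i0 + j <= d)%N -> forall t, bounds (i0 + j) j (i0 + j)
    (fun G _ => t * (minor a #|G| G * moment G)).
  elim: j => [|j IH] jd t.
    rewrite addn0 /bounds i0d; exists (fun _ _ => 0) => [F|G GD vG Gi x _].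
      exact: polyfun0.
    by rewrite m0 // !mulr0 /bdf /bd big1 // => u _; rewrite mulr0.
  rewrite addnS in jd *.
  (* The scalar [t] is quantified in the induction because each step multiplies it by the sign
     occurring in [lam_minor]. *)
  apply: bounds_descent (IH (ltnW jd) (- t * (-1) ^+ (i0 + j))) => //.
  move=> G GD vG Gs x; rewrite -Gs => xV.
  have bd0 : bd D (fun=> 0 : K) G = 0 by rewrite /bd big1 // => u _; rewrite mulr0.
  have E := bd_lin D t (fun=> 0) (fun F => minor a #|F| F * moment F) G.
  have Gd : (#|G| < d)%N by rewrite Gs.
  rewrite bd0 add0r (bd_moment GD Gd) in E.
  have -> : bd D (fun F => t * (minor a #|F| F * moment F)) G =
      t * (minor (fun l => a l.+1) #|G| G * moment G).
    by rewrite -E; apply: eq_bd => u _ _; rewrite add0r.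
  by rewrite -[minor (fun l => a l.+1) _ _]opprK -(lam_minor xV); ring.
have := H (d - i0)%N; rewrite subnKC ?(ltnW i0d) // => /(_ (leqnn _) 1).
rewrite /bounds ltnn => -[f fN fE]; exists f => // F FD vF Fd.
have := fE F FD vF Fd (p F) (pV FD Fd); rewrite mul1r.
rewrite (moment_facet FD Fd).
by move/(mulIf (e_neq0 FD Fd)).
Qed.

End Functional.
End Gluing.

(** * Discriminants of coisotropic subspaces *)

Section Discriminant.
Variable K : fieldType.

Lemma block3_mul m r s (A1 B3 : 'M[K]_(m, s)) (A2 : 'M[K]_(r, s)) :
  col_mx (row_mx 0 (row_mx 0 1%:M))
    (col_mx (row_mx 0 (row_mx 1%:M 0)) (row_mx 1%:M (row_mx 0 0)))
  *m col_mx A1 (col_mx A2 B3) = col_mx B3 (col_mx A2 A1).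
Proof.
by rewrite !mul_col_mx !mul_row_col !mul0mx !mul1mx ?mul0mx ?addr0 ?add0r ?mul0mx ?add0r.
Qed.

(* Pairing the flag (L, L + E, all) with the opposite one (C, C + E, all) makes
   the Gram matrix block triangular. *)
Lemma det_gram_flag m r (W : 'M[K]_(m + (r + m))) (L C : 'M[K]_(m, m + (r + m)))
    (E : 'M[K]_(r, m + (r + m))) :
  W^T = W -> \det W != 0 -> L *m W *m L^T = 0 -> L *m W *m E^T = 0 ->
  col_mx L (col_mx E C) \in unitmx ->
  exists (b : bool) (q : K), q != 0 /\
    \det (E *m W *m E^T) = (-1) ^+ b * \det W * q ^+ 2.
Proof.
move=> WT W0 LL LE QU; set Q := col_mx L _ in QU.
(* [T] exchanges the outer blocks of the flag. Its square is the identity, so its determinant is a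
   sign, left uncomputed. *)
pose T : 'M[K]_(m + (r + m)) := col_mx (row_mx 0 (row_mx 0 1%:M))
    (col_mx (row_mx 0 (row_mx 1%:M 0)) (row_mx 1%:M (row_mx 0 0))).
have TQ : T *m Q = col_mx C (col_mx E L) by rewrite block3_mul.
have T2 : T *m T = 1%:M.
  have TTQ : T *m T *m Q = Q by rewrite -mulmxA TQ block3_mul.
  by rewrite -[LHS](mulmxK QU) TTQ mulmxV.
have detT : (\det T) ^+ 2 = 1 by rewrite expr2 -det_mulmx T2 det1.
have EL : E *m W *m L^T = 0.
  by apply: trmx_inj; rewrite trmx0 !trmx_mul trmxK WT mulmxA.
pose X := L *m W *m C^T.
have CL : C *m W *m L^T = X^T by rewrite /X !trmx_mul trmxK WT mulmxA.
have : \det (Q *m W *m (T *m Q)^T) = \det X ^+ 2 * \det (E *m W *m E^T).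
  rewrite TQ /Q !mul_col_mx !tr_col_mx !mul_mx_row LL LE EL CL -/X.
  set H := E *m W *m E^T; set ea := E *m W *m C^T.
  set ca := C *m W *m C^T; set cb := C *m W *m E^T.
  have -> : col_mx (row_mx X (row_mx 0 0)) (col_mx (row_mx ea (row_mx H 0))
      (row_mx ca (row_mx cb X^T))) = block_mx X 0 (col_mx ea ca) (block_mx H 0 cb X^T).
    rewrite block_mxEv [block_mx H 0 _ _]block_mxEv.
    by rewrite -[row_mx (col_mx _ _) (col_mx _ _)]block_mxEh block_mxEv row_mx0.
  by rewrite !det_lblock det_tr expr2; ring.
rewrite trmx_mul !det_mulmx !det_tr => detE.
have Q0 : \det Q != 0 by rewrite -unitfE -unitmxE.
have T0 : \det T != 0 by apply: contra_eq_neq detT => ->; rewrite expr0n eq_sym oner_eq0.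
have X0 : \det X != 0.
  apply: contraTneq isT => X0; move: detE; rewrite X0 expr0n mul0r => /eqP.
  by rewrite !mulf_eq0 (negbTE Q0) (negbTE T0) (negbTE W0).
have [b bE] : exists b : bool, \det T = (-1) ^+ b.
  move/eqP: detT; rewrite sqrf_eq1 => /orP[] /eqP ->; first by exists false.
  by exists true.
exists b, (\det Q / \det X); split; first by rewrite mulf_neq0 ?invr_eq0.
apply: (mulfI (expf_neq0 2 X0)); rewrite -detE bE expr_div_n.
by field.
Qed.

Lemma det_gram_flag_cast m r f (W : 'M[K]_f) (L C : 'M[K]_(m, f)) (E : 'M[K]_(r, f)) :
  f = (m + (r + m))%N -> W^T = W -> \det W != 0 ->
  L *m W *m L^T = 0 -> L *m W *m E^T = 0 ->
  row_full (col_mx L (col_mx E C)) ->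
  exists (b : bool) (q : K), q != 0 /\
    \det (E *m W *m E^T) = (-1) ^+ b * \det W * q ^+ 2.
Proof.
move=> fE; subst f => WT W0 LL LE; rewrite row_full_unit.
exact: det_gram_flag.
Qed.

(** The kernel [R] is the orthogonal of [U], of rank [f - \rank U], and is isotropic because it lies
    in [U]. With [E] a complement of [R] in [U] and [C] a complement of [U], the flag has the block
    sizes of [det_gram_flag]. *)
Lemma det_gram_coisotropic N f r (W : 'M[K]_f) (U : 'M[K]_(N, f)) (E : 'M[K]_(r, f)) :
  W^T = W -> \det W != 0 -> (kermx (W *m U^T) <= U)%MS -> (E <= U)%MS ->
  (U <= E + kermx (W *m U^T))%MS ->
  (forall c : 'rV[K]_r, (c *m E <= kermx (W *m U^T))%MS -> c = 0) ->
  exists (b : bool) (q : K), q != 0 /\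
    \det (E *m W *m E^T) = (-1) ^+ b * \det W * q ^+ 2.
Proof.
move=> WT W0 RU EU UER ind; set R := kermx _ in RU UER ind.
have rR : \rank R = (f - \rank U)%N.
  have WF : row_full W by rewrite row_full_unit unitmxE unitfE.
  by rewrite mxrank_ker (eqmxMfull _ WF) mxrank_tr.
have rE : \rank E = r.
  apply/eqP/inj_row_free => c cE; apply: ind; rewrite cE; exact: sub0mx.
have capER : (E :&: R)%MS = 0.
  apply/eqP; rewrite -submx0; apply/rV_subP => x; rewrite sub_capmx => /andP[/submxP[c ->] cR].
  by rewrite (ind _ cR) mul0mx sub0mx.
have rU : \rank U = (r + \rank R)%N.
  rewrite -rE -mxrank_disjoint_sum //; apply/eqP; rewrite eqn_leq !mxrankS //.
  by rewrite addsmx_sub EU.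
have rC : \rank (U^C)%MS = \rank R by rewrite mxrank_compl rR.
have fE : f = (\rank R + (r + \rank R))%N.
  by rewrite -rU rR subnK // rank_leq_col.
pose C : 'M_(\rank R, f) := castmx (rC, erefl f) (row_base (U^C)%MS).
have CE : (C :=: U^C)%MS.
  exact: eqmx_trans (eqmx_cast _ _) (eq_row_base _).
have LW : row_base R *m W *m U^T = 0.
  by rewrite -mulmxA; apply/sub_kermxP; rewrite eq_row_base.
have LL : row_base R *m W *m (row_base R)^T = 0.
  have /submxP[c cE] : (row_base R <= U)%MS by rewrite eq_row_base.
  by rewrite {2}cE trmx_mul mulmxA LW mul0mx.
have LE : row_base R *m W *m E^T = 0.
  by have /submxP[c ->] := EU; rewrite trmx_mul mulmxA LW mul0mx.
have ECl : (E <= col_mx E C)%MS by rewrite -addsmxE addsmxSl.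
have ECr : (C <= col_mx E C)%MS by rewrite -addsmxE addsmxSr.
have full : row_full (col_mx (row_base R) (col_mx E C)).
  rewrite -sub1mx -addsmxE.
  have := addsmx_compl_full U; rewrite -sub1mx => /submx_trans; apply.
  rewrite addsmx_sub; apply/andP; split.
    apply: submx_trans UER _; rewrite addsmx_sub.
    by rewrite (submx_trans ECl) ?addsmxSr //= -(eq_row_base R) addsmxSl.
  by apply: submx_trans (addsmxSr _ _); rewrite -CE.
exact: (det_gram_flag_cast fE WT W0 LL LE full).
Qed.
Lemma gram_basis_exists N f (W : 'M[K]_f) (U : 'M[K]_(N, f)) :
  exists r (E : 'M[K]_(r, f)), [/\ (E <= U)%MS,
    (U <= E + kermx (W *m U^T))%MS &
    forall c : 'rV[K]_r, (c *m E <= kermx (W *m U^T))%MS -> c = 0].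
Proof.
set R := kermx _; exists _, (row_base (U :\: R)%MS); split.
- by rewrite eq_row_base diffmxSl.
- rewrite -{1}(addsmx_diff_cap_eq U R) addsmx_sub.
  rewrite -(eq_row_base (U :\: R)%MS) addsmxSl /=.
  exact: submx_trans (capmxSr _ _) (addsmxSr _ _).
move=> c cR; apply: (row_free_inj (row_base_free (U :\: R)%MS)).
rewrite mul0mx; apply/eqP; rewrite -submx0 -(capmx_diff U R) sub_capmx cR andbT.
by rewrite (submx_trans (submxMl _ _)) ?eq_row_base.
Qed.

End Discriminant.

(** * Linear functionals on forms determined by their values on faces *)

Definition facemon n (K : fieldType) (G : {set 'I_n}) : {mpoly K[n]} := \prod_(j in G) 'X_j.

Section Reduction.
Variables (n : nat) (K : fieldType) (D : {set {set 'I_n}}) (b : nat -> 'I_n -> K) (e : nat).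
Variable chi : {mpoly K[n]} -> K.
Implicit Types (p q : {mpoly K[n]}) (m : 'X_{1..n}) (G : {set 'I_n}).

Definition form l : {mpoly K[n]} := \sum_j b l j *: 'X_j.

Lemma meval_form l x : (form l).@[x] = theta_at b l x.
Proof.
by rewrite /form raddf_sum; apply: eq_bigr => j _ /=; rewrite mevalZ mevalXU.
Qed.

Hypothesis chi_lin : forall t p q, p \is e.-homog -> q \is e.-homog ->
  chi (t *: p + q) = t * chi p + chi q.
Hypothesis chi_nonface : forall m, mdeg m = e -> msup m \notin D -> chi 'X_[m] = 0.
Hypothesis chi_form : forall m l, (mdeg m).+1 = e -> (l < e)%N -> chi ('X_[m] * form l) = 0.
Hypothesis chi_face : forall G, G \in D -> #|G| = e -> chi (facemon K G) = 0.
Hypothesis b_minor : forall G, G \in D -> (#|G| <= e)%N -> minor b #|G| G != 0.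

Lemma chi_sum (I : Type) (r : seq I) (P : pred I) (t : I -> K) (F : I -> {mpoly K[n]}) :
  (forall i, P i -> F i \is e.-homog) ->
  chi (\sum_(i <- r | P i) t i *: F i) = \sum_(i <- r | P i) t i * chi (F i).
Proof.
move=> Fh; have sumh s : \sum_(i <- s | P i) t i *: F i \is e.-homog.
  by apply: rpred_sum => i /Fh; apply: dhomogZ.
have chi0 : chi 0 = 0.
  have := chi_lin 1 (dhomog0 _ _ _) (dhomog0 _ _ _); rewrite scale1r addr0 mul1r.
  by move/eqP; rewrite -{1}[chi 0]addr0 (inj_eq (addrI _)) eq_sym => /eqP.
elim: r => [|i r IH]; first by rewrite !big_nil.
rewrite !big_cons; case: ifP => // Pi.
by rewrite chi_lin ?IH ?Fh // sumh.
Qed.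

Lemma squarefree_or_square m :
  'X_[K, m] = facemon K (msup m) /\ mdeg m = #|msup m| \/ exists j, (1 < m j)%N.
Proof.
have [/existsP[j mj]|/existsPn h] := boolP [exists j, 1 < m j]%N; first by right; exists j.
left; have m1 j : m j = (j \in msup m).
  by rewrite inE; have := h j; case: (m j) => [|[|]].
rewrite mpolyXE_id /facemon mdegE -sum1_card [in RHS]big_mkcond [X in _ /\ _ = X]big_mkcond.
by split; apply: eq_bigr => j _; rewrite m1; case: ifP => // _; rewrite ?expr0 ?expr1.
Qed.

(* A square x_v^2 | x^m is traded for x_v x_u with u outside the support, using
   a combination of the forms that is x_v modulo the variables outside it. *)
Lemma chi_monomial m : mdeg m = e -> chi 'X_[m] = 0.
Proof.
(* Every exchange adds a vertex to the support, so the induction runs on [e - #|msup m|]. *)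
move: {2}(e - #|msup m|)%N (leqnn (e - #|msup m|)) => k.
elim: k m => [|k IH] m; rewrite leq_subLR => le me.
all: have [mD|/chi_nonface -> //] := boolP (msup m \in D).
all: have [[-> E]|[v mv]] := squarefree_or_square m; first by rewrite chi_face // -E.
(* A repeated variable makes the support smaller than the degree; in the base case this is already a
   contradiction. *)
all: have lt : (#|msup m| < e)%N.
  1,3: rewrite -me mdegE -sum1_card (bigID (mem (msup m)) xpredT) /=.
  1,2: apply: leq_trans (leq_addr _ _).
  1,2: have vm : v \in msup m by rewrite inE -lt0n ltnW.
  1,2: rewrite (bigD1 v) //= [X in (_ < X)%N](bigD1 v) //= -addSn leq_add //.
  1,2: by apply: leq_sum => j /andP[]; rewrite inE lt0n.
  by move: le; rewrite addn0 leqNgt lt.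
have vm : v \in msup m by rewrite inE -lt0n ltnW.
have [c hc] := dual_cols (erefl #|msup m|) vm (b_minor mD (ltnW lt)).
have lev : (U_(v) <= m)%MM.
  by apply/mnm_lepP => i; rewrite mnm1E; case: eqP => // <-; apply: ltnW.
set m' := (m - U_(v))%MM.
have m'e : (mdeg m').+1 = e.
  by have := mdegD m' U_(v); rewrite /m' submK // me mdeg1 addn1.
pose ga u := \sum_(l < #|msup m|) c l * b l u.
have : chi (\sum_(l < #|msup m|) c l *: ('X_[m'] * form l)) = 0.
  rewrite chi_sum => [|l _].
    by rewrite big1 // => l _; rewrite chi_form ?mulr0 // (leq_trans (ltn_ord l)) // ltnW.
  rewrite -m'e -addn1; apply: dhomogM; first by rewrite dhomogX.
  by apply: rpred_sum => j _; apply: dhomogZ; rewrite dhomogX /= mdeg1.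
have -> : \sum_(l < #|msup m|) c l *: ('X_[m'] * form l) =
    \sum_u ga u *: 'X_[m' + U_(u)].
  rewrite /form; under eq_bigr => l _ do rewrite big_distrr scaler_sumr /=.
  rewrite exchange_big; apply: eq_bigr => u _ /=.
  rewrite /ga scaler_suml; apply: eq_bigr => l _.
  by rewrite -scalerAr scalerA mpolyXD.
rewrite chi_sum => [|u _]; last by rewrite dhomogX /= mdegD mdeg1 addn1 m'e.
rewrite (bigD1 v) //= big1 => [|u uv].
  by rewrite addr0 /ga hc // eqxx mul1r /m' submK.
have [um|um] := boolP (u \in msup m).
  by rewrite /ga hc // (negbTE uv) mul0r.
rewrite IH ?mulr0 //; last by rewrite mdegD mdeg1 addn1.
have -> : msup (m' + U_(u)) = u |: msup m.
  apply/setP => j; rewrite !inE mnmDE mnmBE !mnm1E (eq_sym j u).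
  case: (eqVneq u j) => [<-|uj] /=; first by rewrite addn1.
  rewrite addn0; case: (eqVneq v j) => [<-|]; last by rewrite subn0.
  by rewrite -!lt0n subn_gt0 mv ltnW.
by rewrite cardsU1 um leq_subLR add1n addSnnS.
Qed.

Lemma chi_eq0 p : p \is e.-homog -> chi p = 0.
Proof.
move=> /dhomogP ph; rewrite [p]mpolyE big_seq chi_sum => [|m /ph me].
  by rewrite big1 // => m /ph /chi_monomial ->; rewrite mulr0.
by rewrite dhomogX; apply/eqP.
Qed.

End Reduction.

(** * The degree map as a weighted sum of point evaluations *)

Section DegreeMap.
Variables (k K : fieldType) (f : {rmorphism k -> K}) (d n : nat).
Variables (D : {set {set 'I_n}}) (o : {set 'I_n} -> seq 'I_n) (a : nat -> 'I_n -> K).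
Hypotheses (d2 : (2 <= d)%N) (cD : is_complex D) (dimD : has_dim D d).
Hypotheses (mfD : homology_manifold k D d) (oD : oriented k D o).
Hypothesis inf : exists e : nat -> K, injective e.
Hypothesis minor_neq0 : forall G, G \in D -> minor a #|G| G != 0.
Hypothesis minorS_neq0 : forall G, G \in D -> (#|G| < d)%N ->
  minor (fun i => a i.+1) #|G| G != 0.
Implicit Types (F G U : {set 'I_n}) (q : {mpoly K[n]}).

Definition epsK F : K := (eps k o F)%:~R.
Let clD : closed_down D := complex_closed cD.

Lemma epsK_sign F : exists b : bool, epsK F = (-1) ^+ b.
Proof.
rewrite /epsK /eps; case: ifP => _; first by exists false.
by exists (odd (inversions (o F))); rewrite /seq_sign rmorph_sign signr_odd.
Qed.

Lemma epsK_neq0 F : epsK F != 0.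
Proof. by have [b ->] := epsK_sign F; rewrite signr_eq0. Qed.

Lemma epsK_cycle G : G \in D -> #|G|.+1 = d -> bd D epsK G = 0.
Proof. exact: orientation_cycle. Qed.

Lemma exists_facet U : U \in D -> exists2 F, F \in D & U \subset F /\ #|F| = d.
Proof.
move=> UD; have [F /andP[FD UF] mx] :=
  @arg_maxnP _ U (fun F => (F \in D) && (U \subset F)) (fun F => #|F|)
    (introT andP (conj UD (subxx U))).
exists F => //; split=> //; suff : facet D F by rewrite (facetE cD dimD mfD) => /andP[_ /eqP].
rewrite /facet FD; apply/forallP => G; apply/implyP => GD; apply/implyP => FG.
rewrite eq_sym eqEcard FG; apply: mx.
by rewrite GD (subset_trans UF).
Qed.

Lemma star_acyclic v U s (c : {set 'I_n} -> K) : U \in D -> v \in U ->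
  (#|U| <= s)%N -> (s < d)%N ->
  (forall G, G \in D -> U \subset G -> #|G|.+1 = s -> bd D c G = 0) ->
  exists c', forall G, G \in D -> U \subset G -> #|G| = s -> c G = bd D c' G.
Proof.
move=> UD vU Us sd; apply: star_exact => //.
have U0 : U != set0 by apply/set0Pn; exists v.
have [_ /(_ U UD U0) hom] := mfD.
by rewrite (red_hom_dim_map f) hom (ltn_eqF (ltn_sub2r (leq_ltn_trans Us sd) sd)).
Qed.

Lemma star_top v U (c : {set 'I_n} -> K) : U \in D -> v \in U ->
  (forall G, G \in D -> U \subset G -> #|G|.+1 = d -> bd D c G = 0) ->
  exists t, forall G, G \in D -> U \subset G -> #|G| = d -> c G = t * epsK G.
Proof.
move=> UD vU cyc; have Ud := card_face dimD UD.
move: (Ud); rewrite leq_eqVlt => /predU1P[Ud'|lt].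
  (* When [U] has [d] vertices, it is the only face of that size containing it. *)
  exists (c U / epsK U) => G GD UG Gd.
  have -> : G = U by apply/eqP; rewrite eq_sym eqEcard UG Gd Ud' leqnn.
  by rewrite divfK ?epsK_neq0.
have U0 : U != set0 by apply/set0Pn; exists v.
have [_ /(_ U UD U0) hom] := mfD.
have [F FD [UF Fd]] := exists_facet UD.
apply: (star_top_unique clD lt) => //.
- by rewrite (red_hom_dim_map f) hom eqxx.
- by move=> G; apply: card_face.
- by move=> G GD UG; apply: epsK_cycle.
by exists F => //; rewrite UF Fd eqxx epsK_neq0.
Qed.

Lemma points_exist : exists p : {set 'I_n} -> 'I_n -> K,
  forall F, F \in D -> #|F| = d -> slice a d F (p F).
Proof.
apply: (fin_all_exists (P := fun F x => F \in D -> #|F| = d -> slice a d F x)) => F.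
have [FD|nD] := boolP (F \in D); last by exists (fun=> 0).
have [x [xF xl]] := solve_cols (fun l => (l == 0%N)%:R) (erefl #|F|) (minor_neq0 FD).
by exists x => _ Fd; split=> // l ld; rewrite /lam xl ?subrr // Fd.
Qed.

Variable p : {set 'I_n} -> 'I_n -> K.
Hypothesis pV : forall F, F \in D -> #|F| = d -> slice a d F (p F).

(** Cramer's rule, read off from [cofac_theta] at the ridge [F :\ j]: only the form of index 0
    survives on the left and only the coordinate [p F j] on the right. The resulting minor depends
    on the ridge alone, which [prod_weight] exploits. *)
Lemma point_coord F j : F \in D -> #|F| = d -> j \in F ->
  minor a d F * (-1) ^+ below F j * p F j = minor (fun i => a i.+1) d.-1 (F :\ j).
Proof.
move=> FD Fd jF; have [pF pl] := pV FD Fd.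
have d0 : (0 < d)%N by apply: ltnW.
have Gd : #|F :\ j| = d.-1 by move: Fd; rewrite (cardsD1 j) jF => <-.
have th l : (l < d)%N -> theta_at a l (p F) = (l == 0%N)%:R.
  by move=> /pl/eqP; rewrite subr_eq0 => /eqP.
have := cofac_theta a (p F) Gd.
rewrite big_ord_recl big1 /= ?addr0 => [|l _]; last first.
  by rewrite th ?mulr0 // /bump add1n -ltn_predRL.
rewrite th // mulr1 cofac0 => ->.
rewrite (bigD1 j) /=; last by rewrite !inE eqxx.
rewrite big1 ?addr0 => [|u /andP[uF uj]]; last first.
  by rewrite pF ?mulr0 //; move: uF; rewrite !inE uj.
have -> : below F j = below (F :\ j) j by rewrite -{1}(setD1K jF) below_setU1_self.
by rewrite setD1K // prednK //; ring.
Qed.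

Lemma point_neq0 F j : F \in D -> #|F| = d -> j \in F -> p F j != 0.
Proof.
move=> FD Fd jF; have := point_coord FD Fd jF; apply: contra_eqN => /eqP ->.
rewrite mulr0 eq_sym.
have Gd : #|F :\ j| = d.-1 by move: Fd; rewrite (cardsD1 j) jF => <-.
by rewrite -Gd minorS_neq0 ?(clD FD (subsetDl _ _)) // Gd ltn_predL ltnW.
Qed.

(* The weights for which sum_F weight F * x_G(p F) is the degree of x_G. *)
Definition weight F : K := epsK F / (minor a d F * \prod_(j in F) p F j).

Lemma prod_point_neq0 F : F \in D -> #|F| = d -> \prod_(j in F) p F j != 0.
Proof. by move=> FD Fd; apply/prodf_neq0 => j; apply: point_neq0. Qed.

Lemma minor_facet_neq0 F : F \in D -> #|F| = d -> minor a d F != 0.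
Proof. by move=> FD <-; apply: minor_neq0. Qed.

Lemma weightE F : F \in D -> #|F| = d ->
  minor a d F * (weight F * \prod_(j in F) p F j) = epsK F.
Proof.
move=> FD Fd; rewrite /weight; have := prod_point_neq0 FD Fd.
by have := minor_facet_neq0 FD Fd => m0 p0; field; rewrite m0 p0.
Qed.

Lemma weight_neq0 F : F \in D -> #|F| = d -> weight F != 0.
Proof.
move=> FD Fd; apply: contra_neq (epsK_neq0 F) => w0.
by rewrite -(weightE FD Fd) w0 mul0r mulr0.
Qed.

Definition phi q : K := \sum_(F in D | #|F| == d) weight F * q.@[p F].

Lemma phi_lin t q q' : phi (t *: q + q') = t * phi q + phi q'.
Proof.
rewrite /phi mulr_sumr -big_split; apply: eq_bigr => F _ /=.
by rewrite mevalD mevalZ mulrDr mulrCA.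
Qed.

Lemma phi_nonface m : msup m \notin D -> phi 'X_[m] = 0.
Proof.
move=> mD; rewrite /phi big1 // => F /andP[FD /eqP Fd].
rewrite meval_monomial_supp ?mulr0 //; apply: contra mD => sub.
apply: (clD FD (subset_trans sub _)); apply/subsetP => j; rewrite inE.
by apply: contraNT => jF; have [-> //] := pV FD Fd.
Qed.

Lemma point_form F l : F \in D -> #|F| = d -> (l < d)%N ->
  (form a l).@[p F] = (l == 0%N)%:R.
Proof.
move=> FD Fd ld; rewrite meval_form.
by apply/eqP; rewrite -subr_eq0; apply/eqP; have [_ pl] := pV FD Fd; apply: pl.
Qed.

(** [chi_eq0] is applied to the shifted family [fun i => a i.+1], whose first [d.-1] forms vanish at
    every [p F]. For a ridge, [bd_moment] expresses the value, times a nonzero minor, as the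
    boundary of the cycle [epsK]. *)
Lemma phi_low q : q \is d.-1.-homog -> phi q = 0.
Proof.
have d0 : (0 < d)%N by apply: ltnW.
apply: (@chi_eq0 _ _ D (fun i => a i.+1)).
- by move=> t q1 q2 _ _; apply: phi_lin.
- by move=> m _; apply: phi_nonface.
- move=> m l _ ld; rewrite /phi big1 // => F /andP[FD /eqP Fd].
  have ld' : (l.+1 < d)%N by rewrite -ltn_predRL.
  rewrite mevalM meval_form; have := point_form FD Fd ld'.
  by rewrite meval_form /theta_at => ->; rewrite !mulr0.
- move=> G GD Gd.
  have Gd' : #|G|.+1 = d by rewrite Gd prednK.
  have Glt : (#|G| < d)%N by rewrite -Gd'.
  have := bd_moment clD weight (fun=> 1) pV GD Glt.
  rewrite (@eq_bd _ _ _ _ epsK) => [|u uG uD]; last first.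
    rewrite (moment_facet _ pV weightE) ?mul1r // ?cardsU1 ?uG ?add1n //.
  rewrite epsK_cycle // => /esym/eqP; rewrite mulf_eq0 (negbTE (minorS_neq0 GD Glt)) /=.
  move/eqP => M0; rewrite -{}M0; apply: eq_bigr => F _.
  rewrite mulr1 /facemon rmorph_prod; congr (_ * _).
  by apply: eq_bigr => j _ /=; rewrite mevalXU.
move=> G GD Gd; apply: minorS_neq0 => //; rewrite (leq_ltn_trans Gd) //.
by rewrite ltn_predL.
Qed.

Variable degf : {mpoly K[n]} -> K.
Hypothesis degf_lin : forall t q q', q \is d.-homog -> q' \is d.-homog ->
  degf (t *: q + q') = t * degf q + degf q'.
Hypothesis degf_nonface : forall m, mdeg m = d -> msup m \notin D -> degf 'X_[m] = 0.
Hypothesis degf_form : forall m l, (mdeg m).+1 = d -> (l < d)%N ->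
  degf ('X_[m] * form a l) = 0.
Hypothesis degf_face : forall F, F \in D -> #|F| = d ->
  degf (facemon K F) = epsK F / minor a d F.

(** The difference satisfies the assumptions of [chi_eq0]. The delicate one concerns the form of
    index 0, which is 1 at the points: there [phi] takes the same value as on a monomial of degree
    [d.-1], namely zero by [phi_low]. *)
Lemma degf_phi q : q \is d.-homog -> degf q = phi q.
Proof.
have d0 : (0 < d)%N by apply: ltnW.
move=> qd; apply/eqP; rewrite -subr_eq0; apply/eqP; move: q qd.
apply: (@chi_eq0 _ _ D a d (fun q => degf q - phi q)).
- by move=> t q1 q2 h1 h2; rewrite degf_lin // phi_lin; ring.
- by move=> m md mD; rewrite degf_nonface // phi_nonface // subrr.
- move=> m l md ld; rewrite degf_form // sub0r; apply/eqP; rewrite oppr_eq0; apply/eqP.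
  have [l0|l0] := eqVneq l 0%N; last first.
    rewrite /phi big1 // => F /andP[FD /eqP Fd].
    by rewrite mevalM point_form // (negbTE l0) !mulr0.
  rewrite -(phi_low (q := 'X_[m])); last by rewrite dhomogX /= -md.
  apply: eq_bigr => F /andP[FD /eqP Fd].
  by rewrite mevalM point_form // l0 mulr1.
- move=> G GD Gd; rewrite degf_face //.
  have := moment_facet (fun=> 1) pV weightE GD Gd.
  rewrite mul1r Gd => /(canRL (mulKf (minor_facet_neq0 GD Gd))).
  move=> M; apply/eqP; rewrite subr_eq0 mulrC -M; apply/eqP.
  apply: eq_bigr => F _.
  rewrite mulr1 /facemon rmorph_prod; congr (_ * _).
  by apply: eq_bigr => j _ /=; rewrite mevalXU.
by move=> G GD _; apply: minor_neq0.
Qed.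

Lemma interpolation v i0 (g : {set 'I_n} -> K) : (i0 < d)%N ->
  (forall G, G \in D -> v \in G -> #|G| = i0 ->
    \sum_(F in D | #|F| == d) weight F * g F * \prod_(j in G) p F j = 0) ->
  exists2 h, polyfun (d - i0) h &
    forall F, F \in D -> v \in F -> #|F| = d -> g F = h (p F).
Proof.
move=> i0d m0.
apply: (@moment_interpolation n d K D a epsK v inf clD _ _ minor_neq0 minorS_neq0
  weight g p pV weightE _ i0 i0d m0).
- by move=> U s c; apply: star_acyclic.
- by move=> U c; apply: star_top.
by move=> F _ _; apply: epsK_neq0.
Qed.

(* The values g x_v extend to a polynomial for each v, and sum_v a_(0,v) x_v = 1. *)
Lemma global_interpolation h (g : {set 'I_n} -> K) : d = (h + h)%N ->
  (forall G, G \in D -> #|G| = h ->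
    \sum_(F in D | #|F| == d) weight F * g F * \prod_(j in G) p F j = 0) ->
  exists2 l, polyfun h.+1 l & forall F, F \in D -> #|F| = d -> g F = l (p F).
Proof.
move=> dh m0; have hd : (h < d)%N by move: d2; rewrite dh; case: (h) => // h' _; rewrite addSn ltnS leq_addl.
have [l lh lE] : exists2 l : 'I_n -> ('I_n -> K) -> K, forall v, polyfun h (l v) &
    forall v F, F \in D -> v \in F -> #|F| = d -> g F = l v (p F).
  apply: (fin_all_exists2 (P := fun v l => polyfun h l) (Q := fun v l =>
    forall F, F \in D -> v \in F -> #|F| = d -> g F = l (p F))) => v.
  have [|l] := @interpolation v h g hd; first by move=> G GD _; apply: m0.
  by rewrite {1}dh addnK; exists l.
exists (fun x => \sum_v (0 + a 0 v * (x v * l v x))).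
  apply: polyfun_sum => v _; apply: polyfun_lin; first exact: polyfun0.
  by apply: polyfun_mul_aff; first exact: polyfun_coord.
move=> F FD Fd; have E1 : (form a 0).@[p F] = 1 by rewrite (point_form FD Fd) // ltnW.
rewrite -[LHS]mulr1 -E1 meval_form big_distrr.
apply: eq_bigr => v _ /=; rewrite add0r.
have [vF|vF] := boolP (v \in F); first by rewrite (lE v F) //; ring.
by have [-> //] := pV FD Fd; rewrite mul0r !mulr0.
Qed.

(* Each ridge lies in two facets, so the minors of the ridges occur squared. *)
Lemma prod_ridges (m : {set 'I_n} -> K) :
  \prod_(F in D | #|F| == d) \prod_(j in F) m (F :\ j) =
  (\prod_(G in D | #|G|.+1 == d) m G) ^+ 2.
Proof.
rewrite -prodrXl pair_big_dep /=.
have -> : \prod_(G in D | #|G|.+1 == d) m G ^+ 2 =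
    \prod_(G in D | #|G|.+1 == d) \prod_(u | (u \notin G) && (u |: G \in D)) m G.
  apply: eq_bigr => G /andP[GD /eqP Gd].
  by rewrite prodr_const -(ridge_two_facets d2 cD dimD mfD GD Gd) cardsE.
rewrite pair_big_dep /=.
pose h (x : {set 'I_n} * 'I_n) := (x.2 |: x.1, x.2).
pose h' (x : {set 'I_n} * 'I_n) := (x.1 :\ x.2, x.2).
rewrite (reindex_onto h h') => [|[F j] /andP[_ jF]] /=; last first.
  by rewrite /h /h' /= setD1K.
apply: eq_big => [[G u]|[G u] /andP[_ /eqP []]] /=; last by rewrite /h /h' /= => ->.
rewrite /h /h' /= setU11 andbT xpair_eqE eqxx andbT.
have [uG|uG] := boolP (u \in G).
  rewrite [_ == G]negbTE ?andbF //; apply: contraTneq uG => <-.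
  by rewrite !inE eqxx.
rewrite setU1K // eqxx andbT cardsU1 uG add1n.
case: (boolP (u |: G \in D)) => uD; last by rewrite !andbF.
by rewrite (clD uD (subsetUr _ _)) !andbT.
Qed.

(** By [point_coord], [weight F] times the minors of its ridges is a sign times the power [d.-1] of
    the minor of [F]. This power is odd, and [prod_ridges] turns the ridge minors into a square. *)
Lemma prod_weight : ~~ odd d -> exists (b : bool) (c : K), c != 0 /\
  \prod_(F in D | #|F| == d) weight F =
  (-1) ^+ b * \prod_(F in D | #|F| == d) minor a d F * c ^+ 2.
Proof.
move=> dev; pose m G := minor (fun i => a i.+1) d.-1 G.
pose S := \prod_(G in D | #|G|.+1 == d) m G.
have m0 G : G \in D -> #|G|.+1 = d -> m G != 0.
  by move=> GD Gd; rewrite /m -Gd; apply: minorS_neq0; rewrite ?Gd -?Gd.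
have S0 : S != 0 by apply/prodf_neq0 => G /andP[GD /eqP Gd]; apply: m0.
pose P := \prod_(F in D | #|F| == d) minor a d F.
have P0 : P != 0 by apply/prodf_neq0 => F /andP[FD /eqP Fd]; apply: minor_facet_neq0.
have sg (I : finType) (Q : pred I) (s : I -> K) : (forall i, Q i -> exists b : bool, s i = (-1) ^+ b) ->
    exists b : bool, \prod_(i | Q i) s i = (-1) ^+ b.
  move=> H; apply: (big_ind (fun x => exists b : bool, x = (-1) ^+ b)) => //.
    by exists false.
  by move=> _ _ [b1 ->] [b2 ->]; exists (b1 (+) b2); rewrite signr_addb.
have wE F : F \in D -> #|F| = d -> weight F * \prod_(j in F) m (F :\ j) =
    epsK F * \prod_(j in F) (-1) ^+ below F j * minor a d F ^+ d.-1.
  move=> FD Fd; rewrite /weight.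
  have -> : \prod_(j in F) m (F :\ j) = minor a d F ^+ d *
      (\prod_(j in F) (-1) ^+ below F j * \prod_(j in F) p F j).
    rewrite -{2}Fd -prodr_const -!big_split; apply: eq_bigr => j jF.
    by rewrite /m -(point_coord FD Fd jF) /= mulrA.
  have := prod_point_neq0 FD Fd; have := minor_facet_neq0 FD Fd => M0 Q0.
  have -> : minor a d F ^+ d = minor a d F * minor a d F ^+ d.-1 by rewrite -exprS prednK // ltnW.
  by field; rewrite M0 Q0.
have [b bE] : exists b : bool, \prod_(F in D | #|F| == d)
    (epsK F * \prod_(j in F) (-1) ^+ below F j) = (-1) ^+ b.
  apply: (sg _ _ _) => F _; have [b1 ->] := epsK_sign F.
  have [j _|b2 ->] := sg _ (mem F) (fun j => (-1) ^+ below F j).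
    by exists (odd (below F j)); rewrite signr_odd.
  by exists (b1 (+) b2); rewrite signr_addb.
(* The exponent comes from [d.-1 = 1 + (d./2).-1 * 2]; the denominator removes the product of the
   ridge minors. *)
exists b, (P ^+ (d./2).-1 / S); split.
  by rewrite mulf_neq0 ?invr_eq0 // expf_neq0.
have E : \prod_(F in D | #|F| == d) weight F * S ^+ 2 = (-1) ^+ b * P ^+ d.-1.
  rewrite -prod_ridges -bE -prodrXl -!big_split.
  by apply: eq_bigr => F /andP[FD /eqP Fd] /=; rewrite wE.
have dE : d.-1 = (1 + (d./2).-1 * 2)%N.
  rewrite -{1}(odd_double_half d) (negbTE dev) add0n -muln2.
  by case: (d./2) (half_leq d2) => // h _; rewrite mulSn.
apply: (mulIf (expf_neq0 2 S0)); rewrite E dE exprD exprM expr1 -/P.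
by field.
Qed.

End DegreeMap.

(** * Gram determinants of forms evaluated at finitely many points *)

Section PointGram.
Variables (n f h : nat) (K : fieldType) (pts : 'I_f -> 'I_n -> K) (w : 'I_f -> K).
Implicit Types (q : {mpoly K[n]}).
Hypothesis w_neq0 : forall i, w i != 0.
Variable unit_form : {mpoly K[n]}.
Hypothesis unit_formh : unit_form \is 1.-homog.
Hypothesis unit_form1 : forall i, unit_form.@[pts i] = 1.
Hypothesis coisotropic : forall g : 'I_f -> K,
  (forall q, q \is h.-homog -> \sum_i w i * g i * q.@[pts i] = 0) ->
  exists2 l, polyfun h.+1 l & forall i, g i = l (pts i).

Definition pairing q : K := \sum_i w i * q.@[pts i].

Let ev q : 'rV[K]_f := \row_i q.@[pts i].
Let W : 'M[K]_f := diag_mx (\row_i w i).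
(** Monomials of degree at most [h] form a finite type; those of degree below [h] are replaced by 0,
    so that the rows of [U] span the evaluations of forms of degree [h]. *)
Let mon (m : 'X_{1..n < h.+1}) : {mpoly K[n]} := if mdeg m == h then 'X_[m] else 0.
Let U : 'M[K]_(#|{: 'X_{1..n < h.+1}}|, f) := \matrix_i ev (mon (enum_val i)).

Let mon_homog m : mon m \is h.-homog.
Proof. by rewrite /mon; case: eqP => [mh|]; [rewrite dhomogX; apply/eqP|rewrite dhomog0]. Qed.

Let ev_lin t q q' : ev (t *: q + q') = t *: ev q + ev q'.
Proof. by apply/rowP => i; rewrite !mxE mevalD mevalZ. Qed.

Let ev_sum r (c : 'I_r -> K) (b : 'I_r -> {mpoly K[n]}) :
  ev (\sum_i c i *: b i) = (\row_i c i) *m \matrix_i ev (b i).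
Proof.
apply/rowP => j; rewrite !mxE raddf_sum; apply: eq_bigr => i _ /=.
by rewrite mevalZ !mxE.
Qed.

Let rowspan_homog q : q \is h.-homog -> (ev q <= U)%MS.
Proof.
move/dhomogP => qh; rewrite [q]mpolyE.
have : {in msupp q, forall m : 'X_{1..n}, mdeg m = h} by [].
elim: (msupp q) => [|m r IH] mh.
  rewrite big_nil (_ : ev 0 = 0) ?sub0mx //; apply/rowP => i; by rewrite !mxE meval0.
rewrite big_cons ev_lin addmx_sub ?IH // => [|m' m'r]; last by rewrite mh // inE m'r orbT.
apply: scalemx_sub; have mlt : (mdeg m < h.+1)%N by rewrite mh ?mem_head.
apply/(submx_trans _ (row_sub (enum_rank (BMultinom mlt)) U)).
by rewrite rowK enum_rankK /mon /= mh ?mem_head // eqxx.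
Qed.

(** A power of [unit_form], which is 1 at all the points, makes each monomial homogeneous of degree
    [h] without changing its values there. *)
Let rowspan_polyfun l : polyfun h.+1 l -> ((\row_i l (pts i)) <= U)%MS.
Proof.
apply: (@polyfun_monomials n K (fun l => ((\row_i l (pts i)) <= U)%MS)).
- move=> l1 l2 E; congr (_ <= _)%MS; by apply/rowP => i; rewrite !mxE E.
- by rewrite (_ : \row__ _ = 0) ?sub0mx //; apply/rowP => i; rewrite !mxE.
- move=> t l1 l2 h1 h2; rewrite (_ : \row__ _ = (\row_i l1 (pts i)) + t *: \row_i l2 (pts i)).
    by rewrite addmx_sub // scalemx_sub.
  by apply/rowP => i; rewrite !mxE.
move=> m mh; have hom : 'X_[m] * unit_form ^+ (h - mdeg m) \is h.-homog.
  rewrite -{2}(subnKC (mh : (mdeg m <= h)%N)); apply: dhomogM; first by rewrite dhomogX.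
  by have := dhomogMn (h - mdeg m) unit_formh; rewrite mul1n.
have := rowspan_homog hom; congr (_ <= _)%MS; apply/rowP => i; rewrite !mxE.
by rewrite mevalM rmorphXn /= unit_form1 expr1n mulr1.
Qed.

Let rowspanP x : (x <= U)%MS -> exists2 q, q \is h.-homog & x = ev q.
Proof.
case/submxP => c ->; exists (\sum_i c 0 i *: mon (enum_val i)).
  by apply: rpred_sum => i _; apply: dhomogZ.
by rewrite ev_sum; congr (_ *m _); apply/rowP => i; rewrite !mxE.
Qed.

Let ev_pairing q q' : (ev q *m W *m (ev q')^T) 0 0 = pairing (q * q').
Proof.
rewrite mul_mx_diag mxE; apply: eq_bigr => i _.
by rewrite !mxE mevalM mulrA [X in X * _]mulrC.
Qed.

Let radicalP q : (ev q <= kermx (W *m U^T))%MS <->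
  (forall q', q' \is h.-homog -> pairing (q * q') = 0).
Proof.
split=> [/sub_kermxP + q' /rowspan_homog/submxP[c E]|H].
  by rewrite mulmxA -ev_pairing E trmx_mul mulmxA => ->; rewrite mul0mx mxE.
apply/sub_kermxP; rewrite mulmxA; apply/rowP => i; rewrite [RHS]mxE.
rewrite -(H _ (mon_homog (enum_val i))) -ev_pairing !mxE; apply: eq_bigr => j _.
by congr (_ * _); rewrite !mxE.
Qed.

Let WT : W^T = W. Proof. exact: tr_diag_mx. Qed.

Let detW : \det W = \prod_i w i.
Proof. by rewrite det_diag; apply: eq_bigr => i _; rewrite mxE. Qed.

Let ker_coisotropic : (kermx (W *m U^T) <= U)%MS.
Proof.
apply/rV_subP => x /sub_kermxP xW.
have [q qh|l lh lE] := coisotropic (g := fun i => x 0 i).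
  have /submxP[c E] := rowspan_homog qh.
  have : (x *m W *m (ev q)^T) 0 0 = 0.
    by rewrite E trmx_mul -mulmxA [W *m (_ *m _)]mulmxA mulmxA xW mul0mx mxE.
  rewrite mul_mx_diag mxE => E0; rewrite -[RHS]E0; apply: eq_bigr => i _.
  by rewrite !mxE [X in X * _]mulrC.
have := rowspan_polyfun lh; congr (_ <= _)%MS; apply/rowP => i.
by rewrite !mxE lE.
Qed.

Definition gram_basis r (b : 'I_r -> {mpoly K[n]}) :=
  [/\ forall i, b i \is h.-homog,
      forall q, q \is h.-homog -> exists c : 'I_r -> K,
        forall q', q' \is h.-homog -> pairing ((q - \sum_i c i *: b i) * q') = 0 &
      forall c : 'I_r -> K,
        (forall q', q' \is h.-homog -> pairing ((\sum_i c i *: b i) * q') = 0) ->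
        forall i, c i = 0].

Lemma exists_gram_basis : exists r (b : 'I_r -> {mpoly K[n]}), gram_basis b.
Proof.
have [r [E [EU UE ind]]] := gram_basis_exists W U.
have [b bh bE] : exists2 b : 'I_r -> {mpoly K[n]}, forall i, b i \is h.-homog &
    forall i, row i E = ev (b i).
  apply: (fin_all_exists2 (P := fun i q => q \is h.-homog) (Q := fun i q => row i E = ev q)) => i.
  by apply: rowspanP; apply: submx_trans (row_sub _ _) EU.
have EE : E = \matrix_i ev (b i) by apply/row_matrixP => i; rewrite rowK bE.
exists r, b; split=> // [q qh|c cR].
  have /sub_addsmxP[[c y] /= cy] := submx_trans (rowspan_homog qh) UE.
  exists (fun i => c 0 i); apply/radicalP.
  have -> : ev (q - \sum_i c 0 i *: b i) = y *m kermx (W *m U^T).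
    have := ev_lin (-1) (\sum_i c 0 i *: b i) q; rewrite scaleN1r addrC => ->.
    rewrite ev_sum cy EE scaleN1r (_ : \row_i c 0 i = c) ?addKr //.
    by apply/rowP => i; rewrite mxE.
  exact: submxMl.
move/radicalP: cR; rewrite ev_sum -EE => /ind /rowP c0 i.
by have := c0 i; rewrite !mxE.
Qed.

Lemma det_gram_basis r (b : 'I_r -> {mpoly K[n]}) : gram_basis b ->
  exists (s : bool) (c : K), c != 0 /\
    \det (\matrix_(i, j) pairing (b i * b j)) = (-1) ^+ s * (\prod_i w i) * c ^+ 2.
Proof.
case=> bh span ind; pose E := \matrix_i ev (b i).
have W0 : \det W != 0 by rewrite detW; apply/prodf_neq0 => i _.
have EU : (E <= U)%MS by apply/row_subP => i; rewrite rowK rowspan_homog.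
have [||s [c [c0 E2]]] := det_gram_coisotropic WT W0 ker_coisotropic EU.
- apply/row_subP => i; rewrite rowK.
  have [c /radicalP cR] := span _ (mon_homog (enum_val i)).
  have -> : ev (mon (enum_val i)) = ev (\sum_i c i *: b i) +
      ev (mon (enum_val i) - \sum_i c i *: b i).
    have := ev_lin 1 (\sum_i c i *: b i) (mon (enum_val i) - \sum_i c i *: b i).
    by rewrite !scale1r addrC subrK.
  by rewrite addmx_sub_adds // ev_sum submxMl.
- move=> c cR; apply/rowP => i; rewrite [RHS]mxE.
  apply: (ind (fun i => c 0 i)); apply/radicalP; rewrite ev_sum.
  by rewrite (_ : \row_i c 0 i = c) //; apply/rowP => j; rewrite mxE.
exists s, c; split=> //; rewrite -detW -E2; congr (\det _).
apply/matrixP => i j; rewrite mxE -ev_pairing.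
have row_ev l : ev (b l) = row l E by rewrite rowK.
rewrite !row_ev -row_mul mxE [RHS]mxE; apply: eq_bigr => l _.
by rewrite !mxE.
Qed.

End PointGram.

(** * Generic coefficients *)

Section Generic.
Variables (k : fieldType) (d n : nat).
Local Notation P := (Kpoly k d n).
Local Notation K := (Kfield k d n).
Implicit Types (F G : {set 'I_n}).

(** The default 0 for [l >= d] gives rows indexed by [nat], as [minor] expects. *)
Definition generic_row (l : nat) (j : 'I_n) : P :=
  if insub l is Some i then avar k (i : 'I_d) j else 0.

Definition generic (l : nat) (j : 'I_n) : K := toK (generic_row l j).

Lemma below_onto G m : (m < #|G|)%N -> exists2 j, j \in G & below G j = m.
Proof.
case Gs : #|G| => [//|s] ms.
pose A := [set (inord (below G j) : 'I_s.+1) | j in G].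
have As : #|A| = s.+1.
  rewrite card_in_imset // => u v uG vG /(congr1 val) /=.
  rewrite !inordK -?Gs ?below_lt //; exact: below_inj.
have : (inord m : 'I_s.+1) \in A.
  suff -> : A = setT by rewrite inE.
  by apply/eqP; rewrite eqEcard subsetT cardsT card_ord As leqnn.
case/imsetP => j jG /(congr1 val); rewrite /= !inordK ?(leq_trans ms) -?Gs ?below_lt // => ->.
by exists j.
Qed.

(** The variables are specialized so that the submatrix becomes the identity. The cases [r = 0] and
    [r = 1] supply the two nonvanishing hypotheses on minors. *)
Lemma generic_row_minor_neq0 r s G : #|G| = s -> (r + s <= d)%N ->
  minor (fun i => generic_row (r + i)) s G != 0.
Proof.
move=> Gs rs.
pose x (i : 'I_(d * n)) : k :=
  mxvec (\matrix_(i < d, j < n) ((i == r + below G j :> nat)%N)%:R) 0 i.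
suff : (minor (fun i => generic_row (r + i)) s G).@[x] != 0.
  by apply: contra_neq => ->; rewrite meval0.
rewrite (minor_map (meval x)) (_ : minor _ _ _ = 1) ?oner_eq0 //.
rewrite -(det1 k s) /minor; congr (\det _); apply/matrixP => i m; rewrite !mxE.
have [j jG jm] : exists2 j, j \in G & below G j = m by apply: below_onto; rewrite Gs.
rewrite -jm (below_sum (fun i j => (generic_row (r + i) j).@[x]) i jG) /generic_row.
have lt : (r + i < d)%N by apply: leq_trans rs; rewrite ltn_add2l.
by rewrite (insubT (fun l => l < d)%N lt) mevalXU /x mxvecE mxE /= eqn_add2l jm.
Qed.

Lemma minor_generic r s G :
  minor (fun i => generic (r + i)) s G = toK (minor (fun i => generic_row (r + i)) s G).
Proof. by rewrite /toK (minor_map (@tofrac P)). Qed.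

Lemma generic_minor_neq0 r s G : #|G| = s -> (r + s <= d)%N ->
  minor (fun i => generic (r + i)) s G != 0.
Proof. by move=> Gs rs; rewrite minor_generic /toK tofrac_eq0 generic_row_minor_neq0. Qed.

Lemma minor_bracket F : minor generic d F = toK (bracket k d F).
Proof.
rewrite (minor_generic 0); congr toK; congr (\det _).
apply/matrixP => i m; rewrite !mxE; apply: eq_bigr => j _.
by rewrite /generic_row valK.
Qed.

Lemma Kfield_infinite : (0 < d * n)%N -> exists e : nat -> K, injective e.
Proof.
case: (posnP (d * n)) => // dn _.
exists (fun i => toK ('X_[U_(Ordinal dn) *+ i])) => i j /eqP.
rewrite /toK tofrac_eq => /eqP /(congr1 (mcoeff (U_(Ordinal dn) *+ i))).
rewrite !mcoeffX eqxx; case: eqP => [/mnmP/(_ (Ordinal dn))|_ /eqP]; last by rewrite oner_eq0.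
by rewrite !mulmnE !mnm1E eqxx !mul1n.
Qed.

Lemma theta_form (l : 'I_d) : theta k n l = form generic l.
Proof. by apply: eq_bigr => j _; rewrite /generic /generic_row valK. Qed.

Lemma monomial_facemon (m : 'X_{1..n}) :
  exists q : {mpoly K[n]}, 'X_[m] = q * facemon K (msup m).
Proof.
exists 'X_[[multinom (m j).-1 | j < n]].
rewrite (mpolyXE_id _ m) (mpolyXE_id _ [multinom (m j).-1 | j < n]).
rewrite /facemon [X in _ * X]big_mkcond -big_split; apply: eq_bigr => j _ /=.
rewrite mnmE inE; case: (m j) => [|e] /=; first by rewrite mulr1.
by rewrite exprSr.
Qed.

End Generic.

Lemma pihomogM n (R : comNzRingType) (i j : nat) (q q' : {mpoly R[n]}) :
  q \is i.-homog -> pihomog mdeg (i + j) (q * q') = q * pihomog mdeg j q'.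
Proof.
move=> qi; rewrite [q']mpolyE big_distrr !raddf_sum big_distrr; apply: eq_bigr => m _ /=.
rewrite -scalerAr !linearZ -scalerAr; congr (_ *: _) => /=.
have qm : q * 'X_[m] \is (i + mdeg m).-homog by apply: dhomogM; rewrite ?dhomogX.
rewrite pihomogX; case: eqP => [mj|/eqP mj]; first by rewrite pihomog_dE // -mj.
by rewrite mulr0 (pihomog_ne0 _ qm) // eqn_add2l.
Qed.

(** * The Hodge-Riemann form over the field of generic coefficients *)

Section HodgeRiemann.
Variables (k : fieldType) (d n : nat) (D : {set {set 'I_n}}) (o : {set 'I_n} -> seq 'I_n).
Variable degf : {mpoly Kfield k d n [n]} -> Kfield k d n.
Hypotheses (d2 : (2 <= d)%N) (dev : ~~ odd d) (cD : is_complex D) (dimD : has_dim D d).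
Hypotheses (mfD : homology_manifold k D d) (oD : oriented k D o) (degD : is_deg D o degf).
Local Notation K := (Kfield k d n).
Local Notation a := (@generic k d n).
Local Notation h := d./2.
Implicit Types (F G : {set 'I_n}) (q : {mpoly K[n]}).

Let f : {rmorphism k -> K} := (@tofrac (Kpoly k d n)) \o (@mpolyC (d * n) k).

Let dh : d = (h + h)%N.
Proof. by rewrite -{1}(odd_double_half d) (negbTE dev) addnn. Qed.

Let inf : exists e : nat -> K, injective e.
Proof.
apply: Kfield_infinite; rewrite muln_gt0 (ltnW d2) /=.
case: dimD => -[F _ Fd] _; rewrite -[n]card_ord (leq_trans _ (max_card (mem F))) // Fd.
exact: ltnW.
Qed.

Let minor0 G : G \in D -> minor a #|G| G != 0.
Proof. by move=> GD; apply: (@generic_minor_neq0 k d n 0) => //; rewrite add0n (card_face dimD). Qed.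

Let minorS0 G : G \in D -> (#|G| < d)%N -> minor (fun i => a i.+1) #|G| G != 0.
Proof. by move=> GD Gd; apply: (@generic_minor_neq0 k d n 1). Qed.

Let degf_nonface m : mdeg m = d -> msup m \notin D -> degf 'X_[m] = 0.
Proof.
move=> md mD; case: degD => _ + _; apply; first by rewrite dhomogX; apply/eqP.
have [q qE] := monomial_facemon k d m.
exists (fun N => if N == msup m then q else 0), (fun=> 0).
rewrite (bigD1 (msup m)) //= eqxx big1 => [|N /andP[_ /negbTE ->]]; last by rewrite mul0r.
by rewrite big1 => [|i _]; rewrite ?mul0r ?addr0.
Qed.

Let degf_form m l : (mdeg m).+1 = d -> (l < d)%N -> degf ('X_[m] * form a l) = 0.
Proof.
move=> md ld; case: degD => _ + _; apply.
  rewrite -md -addn1; apply: dhomogM; first by rewrite dhomogX.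
  by apply: rpred_sum => j _; apply: dhomogZ; rewrite dhomogX /= mdeg1.
exists (fun=> 0), (fun i => if i == Ordinal ld then 'X_[m] else 0).
rewrite big1 ?add0r => [|N _]; last by rewrite mul0r.
rewrite (bigD1 (Ordinal ld)) //= eqxx big1 ?addr0 => [|i /negbTE ->]; last by rewrite mul0r.
by rewrite theta_form.
Qed.

Let degf_face F : F \in D -> #|F| = d ->
  degf (facemon K F) = epsK k K o F / minor a d F.
Proof.
move=> FD Fd; case: degD => _ _ dF; rewrite minor_bracket -dF //.
by rewrite (facetE cD dimD mfD) FD Fd eqxx.
Qed.

Let degf_lin t q q' : q \is d.-homog -> q' \is d.-homog ->
  degf (t *: q + q') = t * degf q + degf q'.
Proof. by case: degD => + _ _; apply. Qed.

Variable p : {set 'I_n} -> 'I_n -> K.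
Hypothesis pV : forall F, F \in D -> #|F| = d -> slice a d F (p F).

Let fs := [set F in D | #|F| == d].
Let pts (i : 'I_#|fs|) := p (enum_val i).
Let w (i : 'I_#|fs|) := weight k d o a p (enum_val i).

Let fsP (i : 'I_#|fs|) : enum_val i \in D /\ #|(enum_val i : {set 'I_n})| = d.
Proof. by have := enum_valP i; rewrite inE => /andP[? /eqP]. Qed.

Let sum_fs (X : {set 'I_n} -> K) :
  \sum_(i < #|fs|) X (enum_val i) = \sum_(F in D | #|F| == d) X F.
Proof.
by rewrite -(big_enum_val X) /=; apply: eq_bigl => F; rewrite inE.
Qed.

Let degf_pairing q : q \is d.-homog -> degf q = pairing pts w q.
Proof.
move=> qd; rewrite /pairing (sum_fs (fun F => weight k d o a p F * q.@[p F])).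
exact: (degf_phi f d2 cD dimD mfD oD minor0 minorS0 pV degf_lin degf_nonface degf_form degf_face).
Qed.

Let coiso (g : 'I_#|fs| -> K) :
  (forall q, q \is h.-homog -> \sum_i w i * g i * q.@[pts i] = 0) ->
  exists2 l, polyfun h.+1 l & forall i, g i = l (pts i).
Proof.
(* [g'] extends [g] from the indices of facets to all subsets, the domain of
   [global_interpolation]. *)
move=> g0; pose g' F := \sum_i (enum_val i == F)%:R * g i.
have g'E i : g' (enum_val i) = g i.
  rewrite /g' (bigD1 i) //= eqxx mul1r big1 ?addr0 // => j ji.
  by rewrite (inj_eq enum_val_inj) (negbTE ji) mul0r.
have [|l lh lE] := global_interpolation f d2 cD dimD mfD oD inf minor0 minorS0 pV (g := g') dh.
  move=> G GD Gh; rewrite -(sum_fs (fun F => weight k d o a p F * g' F * \prod_(j in G) p F j)).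
  rewrite -[RHS](g0 (facemon K G)); last first.
    rewrite -Gh -sum1_card /facemon; elim/big_rec2: _ => [|j e q _ qe]; first exact: dhomog1.
    by apply: dhomogM => //; rewrite dhomogX /= mdeg1.
  apply: eq_bigr => i _; rewrite g'E /facemon rmorph_prod; congr (_ * _).
  by apply: eq_bigr => j _ /=; rewrite mevalXU.
by exists l => // i; rewrite -g'E; have [FD Fd] := fsP i; apply: lE.
Qed.

Let homogM q q' : q \is h.-homog -> q' \is h.-homog -> q * q' \is d.-homog.
Proof. by move=> qh q'h; have := dhomogM qh q'h; rewrite -dh. Qed.

Let pihomog_mul q q' : q \is h.-homog -> pihomog mdeg d (q * q') = q * pihomog mdeg h q'.
Proof. by move=> qh; have := pihomogM h q' qh; rewrite -dh. Qed.

(** The degree-[d] part of [q * z] depends only on the degree-[h] part of [z], so testing against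
    forms of degree [h] suffices, and there [Deg] is the pairing. *)
Let gor_idealP q : q \is h.-homog ->
  in_gor_ideal degf q <-> forall q', q' \is h.-homog -> pairing pts w (q * q') = 0.
Proof.
move=> qh; have hom q' : q' \is h.-homog -> q * q' \is d.-homog.
  exact: homogM.
split=> [qI q' q'h|q0 z].
  by rewrite -degf_pairing ?hom // -(qI q') /Deg pihomog_dE // hom.
by rewrite /Deg pihomog_mul // degf_pairing ?hom ?pihomogP // q0 // pihomogP.
Qed.

Let gor_gram_basis r (b : 'I_r -> {mpoly K[n]}) :
  is_gor_basis degf h b <-> gram_basis h pts w b.
Proof.
have sumh (c : 'I_r -> K) : (forall i, b i \is h.-homog) -> \sum_(i < r) c i *: b i \is h.-homog.
  by move=> bh; apply: rpred_sum => i _; apply: dhomogZ.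
split=> -[bh span ind]; split=> // [q qh|c].
- have [c cE] := span q qh; exists c; apply/gor_idealP => //.
  by apply: rpredB; rewrite ?sumh.
- by move=> c0; apply: ind; apply/gor_idealP; rewrite ?sumh.
- have [c cE] := span q qh; exists c; apply/gor_idealP => //.
  by apply: rpredB; rewrite ?sumh.
by move=> /gor_idealP c0; apply: ind; apply: c0; rewrite ?sumh.
Qed.

Let w0 i : w i != 0.
Proof.
by have [FD Fd] := fsP i; apply: (weight_neq0 _ _ d2 cD minor0 minorS0 pV).
Qed.

Let unit_formh : form a 0 \is 1.-homog.
Proof. by apply: rpred_sum => j _; apply: dhomogZ; rewrite dhomogX /= mdeg1. Qed.

Let unit_form1 i : (form a 0).@[pts i] = 1.
Proof. by have [FD Fd] := fsP i; rewrite (point_form pV FD Fd) // ltnW. Qed.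

Lemma gor_basis_exists : exists r (b : 'I_r -> {mpoly K[n]}), is_gor_basis degf h b.
Proof.
have [r [b bB]] := exists_gram_basis h pts w.
by exists r, b; apply/gor_gram_basis.
Qed.

Lemma det_HR_gram r (b : 'I_r -> {mpoly K[n]}) : is_gor_basis degf h b ->
  exists (s : bool) (c : K), c != 0 /\ \det (HR_gram degf h b) =
    (-1) ^+ s * (\prod_(F | facet D F) toK (bracket k d F)) * c ^+ 2.
Proof.
move=> gb; have bh i : b i \is h.-homog by case: gb.
have [s [c [c0 E]]] := det_gram_basis w0 unit_formh unit_form1 coiso ((gor_gram_basis b).1 gb).
have {E}HE : \det (HR_gram degf h b) = (-1) ^+ s * (\prod_i w i) * c ^+ 2.
  rewrite -E; congr (\det _); apply/matrixP => i j; rewrite !mxE.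
  have -> : (d - 2 * h = 0)%N by rewrite mul2n -addnn -dh subnn.
  have bbh : b i * b j \is d.-homog by apply: homogM.
  by rewrite expr0 mul1r /Deg pihomog_dE // degf_pairing.
have [t [c' [c'0 E]]] := prod_weight o d2 cD dimD mfD minor0 minorS0 pV dev.
have wE : \prod_i w i = (-1) ^+ t * (\prod_(F | facet D F) toK (bracket k d F)) * c' ^+ 2.
  rewrite (_ : \prod_i w i = \prod_(F in D | #|F| == d) weight k d o a p F); last first.
    rewrite -(big_enum_val (fun F => weight k d o a p F)) /=.
    by apply: eq_bigl => F; rewrite inE.
  rewrite E; congr (_ * _ * _); apply: eq_big => [F|F _]; last by rewrite minor_bracket.
  by rewrite (facetE cD dimD mfD).
exists (s (+) t), (c' * c); split; first by rewrite mulf_neq0.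
by rewrite HE wE signr_addb; ring.
Qed.

End HodgeRiemann.

Theorem theorem1p1 (k : fieldType) (d n : nat) (D : {set {set 'I_n}})
    (o : {set 'I_n} -> seq 'I_n) (degf : {mpoly Kfield k d n [n]} -> Kfield k d n) :
  (2 <= d)%N -> ~~ odd d ->
  is_complex D -> has_dim D d -> homology_manifold k D d -> oriented k D o ->
  is_deg D o degf ->
  (exists r (b : 'I_r -> {mpoly Kfield k d n [n]}), is_gor_basis degf d./2 b) /\
  (forall r (b : 'I_r -> {mpoly Kfield k d n [n]}),
     is_gor_basis degf d./2 b ->
     \det (HR_gram degf d./2 b) != 0 /\
     exists (lam : k) (c : Kfield k d n),
       [/\ lam != 0, c != 0 &
         \det (HR_gram degf d./2 b)
           = kK d n lam * (\prod_(F : {set 'I_n} | facet D F) toK (bracket k d F)) * c ^+ 2]).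
Proof.
move=> d2 dev cD dimD mfD oD degD.
have [|p pV] := @points_exist (Kfield k d n) d n D (@generic k d n).
  by move=> G GD; apply: (@generic_minor_neq0 k d n 0) => //; rewrite add0n (card_face dimD).
split; first exact: (gor_basis_exists d2 dev cD dimD mfD oD degD pV).
move=> r b gb; have [s [c [c0 E]]] := det_HR_gram d2 dev cD dimD mfD oD degD pV gb.
(* The constant [lam] is a sign, taken in [k]. *)
have lamE : kK d n ((-1) ^+ s : k) = (-1) ^+ s by rewrite /kK /toK !rmorph_sign.
split; last by exists ((-1) ^+ s), c; split; rewrite ?signr_eq0 ?lamE.
rewrite E !mulf_neq0 ?signr_eq0 ?expf_neq0 //.
apply/prodf_neq0 => F; rewrite (facetE cD dimD mfD) => /andP[_ /eqP Fd].
by rewrite -minor_bracket (@generic_minor_neq0 k d n 0) // add0n.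
Qed.
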